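(* Let $n\ge 1$. A $\mathbb{Q}$-basis for the space of quasisymmetric harmonics $\mathrm{HQSym}_n$ is given by $\{V_F(\lambda): F\in\mathsf{For}_n\}$.
   Context: $\mathrm{QSym}_n\subset \mathbb{Z}[x_1,\ldots,x_n]$ is the ring of polynomials such that for every sequence $a_1,\ldots,a_k\ge 1$ the coefficients of $x_{i_1}^{a_1}\cdots x_{i_k}^{a_k}$ and $x_{j_1}^{a_1}\cdots x_{j_k}^{a_k}$ are equal whenever $1\le i_1<\cdots<i_k\le n$ and $1\le j_1<\cdots<j_k\le n$. The quasisymmetric harmonics are $$\mathrm{HQSym}_n=\{f\in\mathbb{Q}[\lambda_1,\ldots,\lambda_n]: g(\tfrac{\partial}{\partial\lambda_1},\ldots,\tfrac{\partial}{\partial\lambda_n})f=0\text{ for all }g\in\mathrm{QSym}_n\text{ with zero constant term}\}.$$ Forests: a binary tree is a finite rooted plane tree in which each node is either a leaf (no children) or internal, having an ordered pair of children $v_L,v_R$; $\ast$ is the tree with a single node (a leaf). An indexed forest is an infinite sequence $F=(T_1,T_2,\ldots)$ of binary trees, all but finitely many equal to $\ast$; $\mathsf{For}$ is the set of indexed forests. The leaves of $F$, read from left to right, are identified with $1,2,3,\ldots$. $\mathrm{IN}(F)$ is the finite set of internal nodes. $\mathrm{supp}(F)$ is the set of leaves of the trees of $F$ different from $\ast$, and $\mathsf{For}_n=\{F\in\mathsf{For}:\mathrm{supp}(F)\subset\{1,\ldots,n\}\}$. Volume polynomials: for $F\in\mathsf{For}$ and a real sequence $\lambda_1\ge\lambda_2\ge\cdots$,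 the forest polytope $\mathbf{C}_{F,\lambda}\subset\mathbb{R}^{\mathrm{IN}(F)}$ is the set of $\phi:\mathrm{IN}(F)\to\mathbb{R}$ such that, extending $\phi$ to $\phi_\lambda$ on $\mathrm{IN}(F)\sqcup\mathrm{supp}(F)$ by $\phi_\lambda(i)=\lambda_i$ on leaves, one has $\phi_\lambda(v_L)\ge\phi(v)\ge\phi_\lambda(v_R)$ for all $v\in\mathrm{IN}(F)$. $V_F(\lambda)$ is the polynomial in $\lambda_1,\lambda_2,\ldots$ (with rational coefficients) given by $V_F(\lambda)=\mathrm{Vol}(\mathbf{C}_{F,\lambda})$ for all such $\lambda$, where $\mathrm{Vol}$ is the Lebesgue measure on $\mathbb{R}^{\mathrm{IN}(F)}$ (equal to $1$ when $\mathrm{IN}(F)=\varnothing$). *)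

(* Defs.v *)
From HB Require Import structures.
From mathcomp Require Import all_boot all_order all_algebra finmap.
From mathcomp Require Import mpoly.
From mathcomp Require Import boolp classical_sets reals ereal.
From mathcomp Require Import measure lebesgue_measure lebesgue_integral.

Set Implicit Arguments.
Unset Strict Implicit.
Unset Printing Implicit Defensive.

Import Order.TTheory GRing.Theory Num.Theory.

Local Open Scope classical_set_scope.
Local Open Scope ring_scope.

Section Basis.
Variables (K : fieldType) (M : lmodType K) (I : eqType).

(* The family [b], restricted to the indices in [S], is a basis of the subspace
   [H] of [M]. Neither [S] nor the dimension of [H] is assumed finite. *)
Definition is_basis (H : set M) (S : set I) (b : I -> M) : Prop :=
  [/\ forall i, S i -> H (b i),
      forall (s : seq I) (c : I -> K), uniq s -> (forall i, i \in s -> S i) ->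
        \sum_(i <- s) c i *: b i = 0 -> forall i, i \in s -> c i = 0
    & forall f, H f -> exists (s : seq I) (c : I -> K),
        [/\ uniq s, forall i, i \in s -> S i & f = \sum_(i <- s) c i *: b i] ].
End Basis.

Section QuasisymmetricHarmonics.
Variable n : nat.

Definition monomial k (i : 'I_k -> 'I_n) (a : 'I_k -> nat) : 'X_{1..n} :=
  (\sum_(t < k) U_(i t) *+ a t)%MM.

Definition QSym : set {mpoly int[n]} :=
  [set g | forall k (a : 'I_k -> nat) (i j : 'I_k -> 'I_n),
     (forall t, 0 < a t)%N ->
     {homo i : s t / (s < t)%N} -> {homo j : s t / (s < t)%N} ->
     g@_(monomial i a) = g@_(monomial j a)].

(* g(d/dlambda_1, ..., d/dlambda_n) f *)
Definition diff_apply (g : {mpoly int[n]}) (f : {mpoly rat[n]}) :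
  {mpoly rat[n]} := \sum_(m <- msupp g) (g@_m)%:~R *: f^`M[m].

Definition HQSym : set {mpoly rat[n]} :=
  [set f | forall g, QSym g -> g@_0%MM = 0 -> diff_apply g f = 0].
End QuasisymmetricHarmonics.

Arguments QSym n : clear implicits.
Arguments HQSym n : clear implicits.

Inductive btree := Leaf | Node of btree & btree.

Fixpoint btree_encode (t : btree) : GenTree.tree unit :=
  match t with
  | Leaf => GenTree.Leaf tt
  | Node l r => GenTree.Node 0 [:: btree_encode l; btree_encode r]
  end.

Fixpoint btree_decode (t : GenTree.tree unit) : btree :=
  match t with
  | GenTree.Node _ [:: l; r] => Node (btree_decode l) (btree_decode r)
  | _ => Leaf
  end.

Lemma btree_encodeK : cancel btree_encode btree_decode.
Proof. by elim=> //= l -> r ->. Qed.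

HB.instance Definition _ := Countable.copy btree (can_type btree_encodeK).

(* A node of a tree is represented by its address: the path from the root to it,
   [false] meaning left child and [true] right child. *)
Fixpoint tree_internal (t : btree) : seq (seq bool) :=
  if t is Node l r then
    [::] :: map (cons false) (tree_internal l)
         ++ map (cons true) (tree_internal r)
  else [::].

(* From left to right. *)
Fixpoint tree_leaves (t : btree) : seq (seq bool) :=
  if t is Node l r then
    map (cons false) (tree_leaves l) ++ map (cons true) (tree_leaves r)
  else [:: [::]].

(* Trees, leaves and the variables lambda are all numbered from 0, so that the
   leaves 1, ..., n of the usual convention are here 0, ..., n - 1. *)
Definition forest := {fsfun nat -> btree with Leaf}.

(* A node of a forest: the position of its tree and its address there. *)
Definition node : Type := (nat * seq bool)%type.

Definition lchild (v : node) : node := (v.1, rcons v.2 false).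
Definition rchild (v : node) : node := (v.1, rcons v.2 true).

Definition leaf_label (F : forest) (v : node) : nat :=
  (\sum_(i < v.1) size (tree_leaves (F i)) + index v.2 (tree_leaves (F v.1)))%N.

(* [finsupp F] consists of the positions of the trees different from [Leaf]. *)
Definition internal (F : forest) : seq node :=
  [seq (i, p) | i <- finsupp F, p <- tree_internal (F i)].

Definition supp (F : forest) : seq nat :=
  [seq leaf_label F (i, p) | i <- finsupp F, p <- tree_leaves (F i)].

Definition IN (F : forest) : finType := seq_sub (internal F).

Definition For (n : nat) : set forest :=
  [set F | forall i, i \in supp F -> (i < n)%N].

Section Volume.
Variable R : realType.

(* Lebesgue measure on R^d, as the d-fold product of [lebesgue_measure]. *)
Fixpoint lebesgue_tuple (d : nat) : set (d.-tuple (measurableTypeR R)) -> \bar R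
  :=
  match d with
  | 0 => dirac [tuple]
  | d'.+1 => pushforward (lebesgue_measure \x @lebesgue_tuple d')%E
               (fun x => [tuple of x.1 :: x.2])
  end.

(* The sets [C] measured below are closed, hence Borel. *)
Definition Vol (I : finType) (C : set (I -> R)) : \bar R :=
  @lebesgue_tuple #|I| [set x | C (fun v => tnth x (enum_rank v))].

Variables (F : forest).

(* phi_lambda *)
Definition extend (lam : nat -> R) (phi : IN F -> R) (v : node) : R :=
  if insub v is Some w then phi w else lam (leaf_label F v).

Definition forest_polytope (lam : nat -> R) : set (IN F -> R) :=
  [set phi | forall v : IN F,
     extend lam phi (lchild (val v)) >= phi v
     /\ phi v >= extend lam phi (rchild (val v))].

Definition is_volume_poly n (p : {mpoly rat[n]}) : Prop :=
  forall lam : nat -> R, (forall i, lam i.+1 <= lam i) ->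
    Vol (forest_polytope lam) =
    ((map_mpoly ratr p).@[fun i : 'I_n => lam i])%:E.

(* V_F as a polynomial in the first [n] variables. It is meant for forests in
   [For n], whose polytope depends on these variables only; the default [0] is
   returned if there is no such polynomial. *)
Definition volume_poly n : {mpoly rat[n]} := xget 0 (@is_volume_poly n).
End Volume.

(* Main.v *)
From HB Require Import structures.
Require Import Defs.
From mathcomp Require Import all_boot all_order all_algebra finmap ssrcomplements.
From mathcomp Require Import mpoly zify ring.
From mathcomp Require Import boolp classical_sets functions reals ereal topology.
From mathcomp Require Import normedtype realfun derive measure lebesgue_measure.
From mathcomp Require Import lebesgue_integral numfun measurable_realfun ftc.

(** Why the theorem holds.

    Volumes.  Let the leaves of a binary tree T carry decreasing values, and
    let m_k(T) be the integral of y^k/k! over the polytope of T, where y is the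
    coordinate of the root (the value of the leaf if T is a leaf).  For fixed
    values x >= x' at the children of the root, y ranges over [x', x], and the
    integral of y^k/k! is x^(k+1)/(k+1)! - x'^(k+1)/(k+1)!.  Hence
      m_k(Node L R) = m_{k+1}(L) m_0(R) - m_0(L) m_{k+1}(R),
    with m_k = lambda^k/k! for a leaf.  This recursion is the definition of
    [moment], over any commutative ring.  Thus m_0 is the volume of the polytope
    of a tree, and the volume polynomial of a forest is the product of the m_0
    of its trees ([tree_moments], [Vol_forest], [volume_polyE]).

    Harmonics.  QSym_n is spanned by the monomial quasisymmetric polynomials
    M_alpha.  On two consecutive blocks of variables, M_alpha is the sum of
    M_beta M_gamma over the factorizations alpha = beta gamma, so the recursion
    gives at once how the operator M_alpha(d/dlambda) acts on moments: it sends
    m_k(T) to m_{k-a}(T) if alpha = (a), and to 0 if alpha has at least two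
    parts ([diffop_moment]).  In particular it kills m_0(T), and products of
    such volumes in disjoint variables ([diffop_volume_prod]).

    Independence.  Order monomials lexicographically, the first variable
    counting first.  In the recursion the least monomial comes from the second
    term, so in the least monomial of V_F the exponent c_i of lambda_i is the
    number of internal nodes whose rightmost leaf is i ([lexmin_volume_prod]).
    The sequence c is a program for a stack machine: for each i, push a leaf,
    then merge c_i times the two topmost trees.  The machine rebuilds F
    ([parse_leaf_codes]), so different forests have different least monomials;
    and the programs of the forests in For_n are exactly the ballot sequences,
    those with c_1 + ... + c_i <= i - 1 for all i <= n ([ballot_parse]).

    Spanning.  The least monomial of a nonzero quasisymmetric harmonic is also
    ballot ([HQSym_lexmin_ballot]), so subtracting multiples of volume
    polynomials reduces every harmonic to 0.  The proof is the straightening of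
    Aval, Bergeron and Bergeron: if c is not ballot, the ideal generated by the
    quasisymmetric polynomials without constant term contains a polynomial
    whose lexicographically greatest monomial is x^c ([straighten]), and the
    differential operator it defines would extract the coefficient of the least
    monomial c. *)

Set Implicit Arguments.
Unset Strict Implicit.
Unset Printing Implicit Defensive.
Import Order.TTheory GRing.Theory Num.Theory.
Import numFieldNormedType.Exports.

(** * Leaf codes of forests and their stack parser *)

Fixpoint nleaves (t : btree) : nat :=
  if t is Node l r then (nleaves l + nleaves r)%N else 1%N.

(** Letter i is the number of internal nodes whose rightmost leaf is the i-th
    leaf.  The parameter k, added to the last letter, counts the ancestors of
    which the tree is a rightmost branch: it makes the recursion structural. *)
Fixpoint leaf_code (t : btree) (k : nat) : seq nat :=
  if t is Node l r then leaf_code l 0 ++ leaf_code r k.+1 else [:: k].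

Definition leaf_codes (ts : seq btree) : seq nat :=
  flatten [seq leaf_code t 0 | t <- ts].

Lemma nleaves_gt0 t : (0 < nleaves t)%N.
Proof. by elim: t => //= l hl r hr; rewrite addn_gt0 hl. Qed.

Lemma size_tree_leaves t : size (tree_leaves t) = nleaves t.
Proof. by elim: t => //= l hl r hr; rewrite size_cat !size_map hl hr. Qed.

Lemma size_leaf_code t k : size (leaf_code t k) = nleaves t.
Proof. by elim: t k => //= l hl r hr k; rewrite size_cat hl hr. Qed.

Lemma size_leaf_codes ts : size (leaf_codes ts) = sumn [seq nleaves t | t <- ts].
Proof. by elim: ts => //= t ts IH;
  rewrite /leaf_codes /= size_cat -/(leaf_codes ts) IH size_leaf_code. Qed.

Lemma leaf_codes_cat ts us : leaf_codes (ts ++ us) = leaf_codes ts ++ leaf_codes us.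
Proof. by rewrite /leaf_codes map_cat flatten_cat. Qed.

Definition merge_top (st : seq btree) : seq btree :=
  if st is r :: l :: st' then Node l r :: st' else st.

Definition merges k (st : seq btree) := iter k merge_top st.

(** Shift-reduce parser: the letter a pushes a leaf, then closes a internal
    nodes.  The head of the list is the top of the stack. *)
Fixpoint parse (st : seq btree) (c : seq nat) : seq btree :=
  if c is a :: c' then parse (merges a (Leaf :: st)) c' else st.

(** After the letters of l the tree l is on the stack; those of r, with one
    more merge, put r above it and then close the node. *)
Lemma parse_leaf_code t k st c :
  parse st (leaf_code t k ++ c) = parse (merges k (t :: st)) c.
Proof.
elim: t k st c => //= l hl r hr k st c; rewrite -catA hl /= hr.
by rewrite /merges iterSr.
Qed.

Lemma parse_leaf_codes ts st : parse st (leaf_codes ts) = rev ts ++ st.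
Proof.
elim: ts st => //= t ts IH st; rewrite /leaf_codes /= parse_leaf_code /= IH rev_cons.
by rewrite cat_rcons.
Qed.

Lemma leaf_codes_inj : injective leaf_codes.
Proof.
move=> ts us /(congr1 (parse [::])); rewrite !parse_leaf_codes !cats0.
by move/(congr1 rev); rewrite !revK.
Qed.

(** h is the number of trees on the stack of the parser before it reads c: a
    merges are possible after a push exactly when a <= h. *)
Fixpoint ballot (h : nat) (c : seq nat) : bool :=
  if c is a :: c' then (a <= h) && ballot (h.+1 - a) c' else true.

Lemma leaf_code_rcons t : exists u m, forall k, leaf_code t k = rcons u (m + k).
Proof.
elim: t => [|l _ r [u [m hu]]] /=; first by exists [::], 0.
by exists (leaf_code l 0 ++ u), m.+1 => k; rewrite hu rcons_cat addSnnS.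
Qed.

Lemma leaf_codes_rcons ts t : leaf_codes (rcons ts t) = leaf_codes ts ++ leaf_code t 0.
Proof. by rewrite -cats1 leaf_codes_cat /leaf_codes /= cats0. Qed.

(** Merging makes the rightmost leaf of the top tree the rightmost leaf of one
    more internal node. *)
Lemma leaf_codes_merges a st u k : (a < size st)%N ->
  leaf_codes (rev st) = rcons u k ->
  size (merges a st) = (size st - a)%N /\
  leaf_codes (rev (merges a st)) = rcons u (k + a).
Proof.
elim: a => [|a IH] ha hc; first by rewrite subn0 addn0.
have [h1 h2] := IH (ltnW ha) hc; rewrite /merges iterS -/(merges a st).
case: (merges a st) h1 h2 => [|r [|l s]] /=; [lia|lia|move=> h1 h2; split; first lia].
move: h2; rewrite !rev_cons !leaf_codes_rcons /=.
have [v [m hv]] := leaf_code_rcons r; rewrite !hv -rcons_cat => /rcons_inj[hu hk].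
by rewrite catA -rcons_cat hu; congr rcons; lia.
Qed.

Lemma ballot_rcons h c a :
  ballot h (rcons c a) -> ballot h c /\ (sumn c + a <= h + size c)%N.
Proof.
elim: c h => [|b c IH] h /=; first by rewrite andbT; lia.
by case/andP=> hb /IH[-> h2]; rewrite hb; split=> //; lia.
Qed.

Lemma ballot_parse c : ballot 0 c ->
  exists ts, leaf_codes ts = c /\ size ts + sumn c = size c.
Proof.
elim/last_ind: c => [|c a IH]; first by exists [::].
move=> /ballot_rcons[/IH[ts [hts hs]] hle].
have hsz : (a < size (Leaf :: rev ts))%N by rewrite /= size_rev; lia.
have hc : leaf_codes (rev (Leaf :: rev ts)) = rcons c 0.
  by rewrite rev_cons revK leaf_codes_rcons hts /= cats1.
have [h1 h2] := leaf_codes_merges hsz hc.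
exists (rev (merges a (Leaf :: rev ts))); rewrite h2 add0n; split=> //.
by rewrite size_rev h1 sumn_rcons size_rcons /= size_rev; lia.
Qed.

Lemma ballot_mono h h' u : (h <= h')%N -> ballot h u -> ballot h' u.
Proof.
elim: u h h' => //= a u IH h h' hh /andP[ha hu]; apply/andP; split; first lia.
by apply: IH hu; lia.
Qed.

(** The two ways in which the straightening shortens a word keep it
    non-ballot. *)
Lemma ballot_insert0 h u a v :
  ballot h (u ++ a.+1 :: v) || ballot h (u ++ a :: v) -> ballot h (u ++ 0 :: a.+1 :: v).
Proof.
elim: u h => [|b u IH] h /=.
  rewrite subn0; case/orP => /andP[ha hv]; last by rewrite ltnS ha.
  by rewrite ltnS (ltnW ha); apply: ballot_mono hv; lia.
by case/orP=> /andP[-> h2] /=; apply: IH; rewrite h2 ?orbT.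
Qed.

Lemma ballot_insert0_end h u : ballot h u -> ballot h (u ++ [:: 0]).
Proof. by elim: u h => //= b u IH h /andP[-> /IH]. Qed.

Local Open Scope ring_scope.

(** * Divided moments of a tree *)

Section TreeMoments.
Variable A : comNzRingType.
Implicit Type x : nat -> nat -> A.

(** If x p k is lambda_p^k/k!, this is the integral of y^k/k! over the polytope
    of t, y being the value at the root and o the index of its first leaf. *)
Fixpoint moment x (t : btree) (o k : nat) : A :=
  match t with
  | Leaf => x o k
  | Node l r => moment x l o k.+1 * moment x r (o + nleaves l)%N 0%N
              - moment x l o 0%N * moment x r (o + nleaves l)%N k.+1
  end.

Fixpoint volume_prod x (ts : seq btree) (o : nat) : A :=
  if ts is t :: ts' then moment x t o 0%N * volume_prod x ts' (o + nleaves t)%N else 1.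

(** Any replacement of the divided powers by a series in lower ones, with
    leading coefficient 1, commutes with the recursion: the extra term created
    by the passage from k to k+1 is the same in both products and cancels.
    Replacing lambda by lambda - c is of this kind. *)
Lemma moment_shift x x' (w : nat -> A) t o : w 0%N = 1 ->
  (forall p k, x' p k = \sum_(j < k.+1) w j * x p (k - j)%N) ->
  forall k, moment x' t o k = \sum_(j < k.+1) w j * moment x t o (k - j)%N.
Proof.
move=> w0 hx; elim: t o => [|l hl r hr] o k /=; first exact: hx.
have hl0 : moment x' l o 0%N = moment x l o 0%N by rewrite hl big_ord1 w0 mul1r.
have hr0 p : moment x' r p 0%N = moment x r p 0%N by rewrite hr big_ord1 w0 mul1r.
rewrite hl0 hr0 hl hr 2!(big_ord_recr k.+1) /= subnn.
under [in RHS]eq_bigr do rewrite mulrBr.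
have e (i : 'I_k.+1) : (k.+1 - i = (k - i).+1)%N by case: i => i /= ; lia.
under eq_bigr do rewrite e.
under [X in _ - _ * (X + _)]eq_bigr do rewrite e.
rewrite sumrB [X in _ = X - _](eq_bigr (fun j : 'I_k.+1 => 
  (w j * moment x l o (k - j).+1) * moment x r (o + nleaves l) 0)); last by move=> i _;
    ring.
rewrite -mulr_suml [X in _ = _ - X](eq_bigr (fun j : 'I_k.+1 => 
  moment x l o 0%N * (w j * moment x r (o + nleaves l) (k - j).+1)));
    last by move=> i _; ring.
rewrite -mulr_sumr; ring.
Qed.

(** The volume is invariant under translation of lambda. *)
Lemma moment_shift0 x x' (w : nat -> A) t o : w 0%N = 1 ->
  (forall p k, x' p k = \sum_(j < k.+1) w j * x p (k - j)%N) ->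
  moment x' t o 0 = moment x t o 0.
Proof. by move=> w0 hx; rewrite (moment_shift t o w0 hx) big_ord1 w0 mul1r. Qed.

Lemma eq_moment x x' t o k :
  (forall p j, (o <= p < o + nleaves t)%N -> x p j = x' p j) ->
  moment x t o k = moment x' t o k.
Proof.
elim: t o k => [|l hl r hr] o k h /=; first by apply: h => /=; lia.
have := nleaves_gt0 l; have := nleaves_gt0 r => hl0 hr0.
by rewrite !(hl o, hr) // => p j hp; apply: h => /=; lia.
Qed.
End TreeMoments.

Lemma rmorph_moment (A B : comNzRingType) (h : {rmorphism A -> B}) x t o k :
  h (moment x t o k) = moment (fun p j => h (x p j)) t o k.
Proof. by elim: t o k => //= l hl r hr o k; rewrite rmorphB !rmorphM hl hl hr hr. Qed.

(** * Compositions and quasisymmetric differential operators *)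

Section Compositions.
Variable n : nat.
Implicit Types (s : seq 'I_n) (m : 'X_{1..n}) (al : seq nat).

(** The composition of a monomial, read along a list of variables. *)
Definition nonzero_exps s m : seq nat := [seq m i | i <- s & m i != 0%N].

(** The monomials of the monomial quasisymmetric polynomial of al in the
    variables s: the first variable is either skipped or takes the first part. *)
Fixpoint monomials_along al s : seq 'X_{1..n} :=
  match al, s with
  | [::], _ => [:: 0%MM]
  | _ :: _, [::] => [::]
  | a :: al', i :: s' => monomials_along al s' ++ [seq (U_(i) *+ a +
    m)%MM | m <- monomials_along al' s']
  end.

Lemma monomials_along_nil s :
  monomials_along [::] s = [:: 0%MM]. Proof. by case: s. Qed.

Lemma monomials_along_supp al s m i :
  m \in monomials_along al s -> i \notin s -> m i = 0%N.
Proof.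
elim: s al m => [|j s IH] [|a al] m //=; rewrite ?inE ?monomials_along_nil ?inE.
- by move=> /eqP -> _; rewrite mnm0E.
- by move=> /eqP -> _; rewrite mnm0E.
rewrite mem_cat negb_or => /orP[/IH h /andP[_ /h]//|/mapP[m' /IH h ->] /andP[hij /h]].
by rewrite mnmDE mulmnE mnm1E eq_sym (negbTE hij) => ->.
Qed.

Lemma mem_monomials_along al s m : uniq s -> all (leq 1) al ->
  (m \in monomials_along al s) = (nonzero_exps s m == al) && all (fun i =>
    (i \in s) || (m i == 0%N)) (enum 'I_n).
Proof.
elim: s al m => [|j s IH] al m /=.
  move=> _; case: al => [|a al] _ //=; rewrite inE.
  apply/eqP/allP => [-> i _|h]; first by rewrite mnm0E.
  by apply/mnmP=> i; rewrite mnm0E; apply/eqP/(h i); rewrite mem_enum.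
case/andP=> hj us; case: al => [_|a al /= /andP[ha hal]].
  rewrite inE; apply/eqP/andP => [->|[/eqP h /allP h2]].
    split; last by apply/allP=> i _; rewrite mnm0E eqxx orbT.
    by rewrite /nonzero_exps (eq_filter (a2 := pred0)) ?filter_pred0 // => i;
      rewrite mnm0E.
  apply/mnmP=> i; rewrite mnm0E; apply/eqP/negPn/negP => hi.
  have := h2 i; rewrite mem_enum (negbTE hi) orbF => /(_ isT) his.
  have : m i \in nonzero_exps (j :: s) m by apply: map_f; rewrite mem_filter hi.
  by rewrite h.
rewrite mem_cat IH //=; last by rewrite ha.
rewrite /nonzero_exps /=; case: (altP (m j =P 0%N)) => [mj|mj] /=.
  rewrite [X in _ || X](_ : _ = false) ?orbF.
    congr (_ && _); apply: eq_all => i /=; rewrite inE.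
    by case: (altP (i =P j)) => [->|_]; rewrite ?mj ?eqxx ?orbT.
  apply/negP => /mapP[m' _ hm]; move: mj; rewrite hm mnmDE mulmnE mnm1E eqxx.
  by case: a ha {hm}.
rewrite [X in X || _](_ : _ = false) /=; last first.
  apply/negbTE/negP => /andP[_ /allP/(_ j)]; rewrite mem_enum => /(_ isT).
  by rewrite (negbTE hj) (negbTE mj).
apply/mapP/andP => [[m' hm' ->]|[]].
  have m'j : m' j = 0%N by apply: monomials_along_supp hm' hj.
  have hne i : i \in s -> (U_(j) *+ a + m')%MM i = m' i.
    move=> his; rewrite mnmDE mulmnE mnm1E.
    by case: eqP => [ji|]; [move: his; rewrite -ji (negbTE hj)|].
  rewrite (eq_in_filter (a2 := fun i => m' i != 0%N)); last by move=> i /hne ->.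
  move: hm'; rewrite IH // => /andP[/eqP hc /allP h2]; split.
    rewrite mnmDE mulmnE mnm1E eqxx m'j addn0 mul1n; apply/eqP; congr (_ :: _).
    by rewrite -hc /nonzero_exps; apply/eq_in_map => i;
      rewrite mem_filter => /andP[_ /hne].
  apply/allP => i hi; have := h2 i hi; rewrite inE mnmDE mulmnE mnm1E (eq_sym i j).
  by case: (j =P i) => [_ _ |_] ;rewrite ?mul0n.
case/eqP=> hma hc /allP h2; exists (m - U_(j) *+ a)%MM; last first.
  apply/mnmP => i; rewrite mnmDE mnmBE mulmnE mnm1E; case: eqP => [<-|]; last lia.
  by rewrite hma; lia.
have hne i : i \in s -> (m - U_(j) *+ a)%MM i = m i.
  move=> his; rewrite mnmBE mulmnE mnm1E.
  by case: eqP => [ji|]; [move: his; rewrite -ji (negbTE hj)|rewrite subn0].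
rewrite IH //; apply/andP; split.
  rewrite /nonzero_exps (eq_in_filter (a2 := fun i => m i != 0%N));
    last by move=> i /hne ->.
  rewrite -hc; apply/eqP/eq_in_map => i; rewrite mem_filter => /andP[_ /hne //].
apply/allP => i hi; have := h2 i hi; rewrite inE mnmBE mulmnE mnm1E (eq_sym i j).
by case: (j =P i) => [<-|]; [rewrite hma mul1n subnn orbT|rewrite subn0].
Qed.

Lemma uniq_monomials_along al s :
  uniq s -> all (leq 1) al -> uniq (monomials_along al s).
Proof.
elim: s al => [|j s IH] [|a al] //= /andP[hj us] /andP[ha hal].
rewrite cat_uniq IH //=; last by rewrite ha.
rewrite map_inj_uniq; last exact: addmI.
rewrite IH // andbT; apply/hasPn => m /mapP[m' _ ->];
  apply/negP => /monomials_along_supp.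
move/(_ j hj); rewrite mnmDE mulmnE mnm1E eqxx; lia.
Qed.

Definition composition m := nonzero_exps (enum 'I_n) m.

Lemma mem_monomials_enum al m :
  all (leq 1) al -> (m \in monomials_along al (enum 'I_n)) = (composition m == al).
Proof.
move=> hal; rewrite mem_monomials_along ?enum_uniq //; case: eqP => //= _.
by apply/allP => i ->.
Qed.

Lemma composition_pos m : all (leq 1) (composition m).
Proof. by apply/allP => a /mapP[i]; rewrite mem_filter lt0n => /andP[h _] ->. Qed.

Lemma composition_nil m : composition m = [::] -> m = 0%MM.
Proof.
move=> h; have : m \in monomials_along [::] (enum 'I_n) by rewrite mem_monomials_enum
  // h.
by rewrite monomials_along_nil inE => /eqP.
Qed.

Lemma composition0 : composition 0%MM = [::].
Proof. by rewrite /composition /nonzero_exps (eq_filter (a2 := pred0)) ?filter_pred0 //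
  => i; rewrite mnm0E. Qed.

Lemma sorted_enum_ord k : sorted (fun i j : 'I_k => (i < j)%N) (enum 'I_k).
Proof.
have := iota_ltn_sorted 0 k; rewrite -val_enum_ord sorted_map.
by apply: sub_sorted.
Qed.

Lemma homo_inj k (i : 'I_k -> 'I_n) : {homo i : s t / (s < t)%N} -> injective i.
Proof.
move=> h s t hst; apply: val_inj; case: (ltngtP s t) => // /h; rewrite hst ltnn //.
Qed.

Lemma monomialE k (i : 'I_k -> 'I_n) a t :
  {homo i : s t / (s < t)%N} -> monomial i a (i t) = a t.
Proof.
move=> hi; rewrite /monomial mnm_sumE (bigD1 t) //= mulmnE mnm1E eqxx mul1n.
rewrite big1 ?addn0 // => u hu; rewrite mulmnE mnm1E.
by rewrite (inj_eq (homo_inj hi)) (negbTE hu).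
Qed.

Lemma composition_monomial k (i : 'I_k -> 'I_n) a :
  (forall t, 0 < a t)%N -> {homo i : s t / (s < t)%N} ->
  composition (monomial i a) = [seq a t | t <- enum 'I_k].
Proof.
move=> ha hi; rewrite /composition /nonzero_exps.
(* both lists are increasing, with the same members *)
have -> : [seq j <- enum 'I_n | monomial i a j != 0%N] = map i (enum 'I_k).
  apply: (@irr_sorted_eq _ (fun i j : 'I_n => (i < j)%N)).
  - by move=> x y z; apply: ltn_trans.
  - by move=> x; apply: ltnn.
  - by apply: sorted_filter (sorted_enum_ord n) => x y z; apply: ltn_trans.
  - by rewrite sorted_map; apply: sub_sorted (sorted_enum_ord k) => x y; apply: hi.
  move=> j; rewrite mem_filter mem_enum andbT; apply/idP/mapP => [|[t _ ->]];
    last first.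
    by rewrite monomialE // -lt0n.
  rewrite /monomial mnm_sumE => h;
    have : (0 < \sum_(t < k) (U_(i t) *+ a t)%MM j)%N by rewrite lt0n.
  rewrite lt0n sum_nat_eq0 negb_forall => /existsP[t]; rewrite mulmnE mnm1E.
  by case: (i t =P j) => //= <- _; exists t => //; rewrite mem_enum.
by rewrite -map_comp; apply: eq_map => t /=; rewrite monomialE.
Qed.

Lemma monomial_of_composition m : exists i : 'I_(size (composition m)) -> 'I_n,
  {homo i : s t / (s < t)%N} /\ m = monomial i (fun t => nth 0%N (composition m) t).
Proof.
rewrite /composition /nonzero_exps size_map.
case es : ([seq i <- enum 'I_n | m i != 0%N]) => [|j0 s0].
  exists (fun t : 'I_0 => match t with Ordinal _ lt => False_rect _ (notF lt) end);
    split.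
    by case.
  rewrite /monomial big_ord0; apply: composition_nil;
    by rewrite /composition /nonzero_exps es.
rewrite -es; set s := seq.filter _ _.
have ss : sorted (fun i j : 'I_n => (i < j)%N) s.
  by apply: sorted_filter (sorted_enum_ord n) => x y z; apply: ltn_trans.
pose i (t : 'I_(size s)) := nth j0 s t.
have hi : {homo i : s t / (s < t)%N}.
  move=> t u htu; rewrite /i.
  by apply: (sorted_ltn_nth _ j0 ss) => //; rewrite ?inE //; move=> x y z;
    apply: ltn_trans.
exists i; split => //; apply/mnmP => j.
case: (boolP (j \in s)) => hj.
  have hlt : (index j s < size s)%N by rewrite index_mem.
  have ej : j = i (Ordinal hlt) by rewrite /i /= nth_index.
  by rewrite [in RHS]ej monomialE //= (nth_map j0) //= nth_index.
have -> : m j = 0%N.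
  by apply/eqP/negPn/negP => h; move: hj; rewrite mem_filter h mem_enum.
rewrite /monomial mnm_sumE big1 // => t _; rewrite mulmnE mnm1E.
by case: eqP => // e; move: hj; rewrite -e mem_nth.
Qed.

(** A monomial is determined by its composition and the increasing sequence of
    the positions of its nonzero exponents, and the latter is arbitrary. *)
Lemma QSym_composition (g : {mpoly int[n]}) : QSym n g <->
  (forall m m', composition m = composition m' -> g@_m = g@_m').
Proof.
split=> [hg m m' e|h k a i j ha hi hj]; last by apply: h; rewrite !composition_monomial.
have [i [hi ->]] := monomial_of_composition m;
  have [j [hj ->]] := monomial_of_composition m'.
move: j hj; rewrite -e => j hj; apply: hg => // t.
by apply/(all_nthP 0%N (composition_pos m)).
Qed.
End Compositions.

Section Action.
Variable n : nat.
Implicit Types (s : seq 'I_n) (m : 'X_{1..n}) (al : seq nat) (f g h : {mpoly rat[n]}).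

(** The operator g(d/dlambda_1, ..., d/dlambda_n), for rational coefficients. *)
Definition diffop g f : {mpoly rat[n]} := \sum_(m <- msupp g) g@_m *: f^`M[m].

Lemma diffop_bound k g f : (msize g <= k)%N ->
  diffop g f = \sum_(m : 'X_{1..n < k}) g@_m *: f^`M[m].
Proof.
move=> hk; rewrite /diffop (big_mksub 'X_{1..n < k}) /=; first last.
- by move=> m /msize_mdeg_lt /leq_trans; apply.
- exact: msupp_uniq.
by rewrite big_rmcond //= => m /memN_msupp_eq0 ->; rewrite scale0r.
Qed.

Lemma diffopD g h f : diffop (g + h) f = diffop g f + diffop h f.
Proof.
pose k := maxn (msize (g + h)) (maxn (msize g) (msize h)).
rewrite !(@diffop_bound k) ?leq_max ?leqnn ?orbT // -big_split /=.
by apply: eq_bigr => m _; rewrite mcoeffD scalerDl.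
Qed.

Lemma diffopZ c g f : diffop (c *: g) f = c *: diffop g f.
Proof.
pose k := maxn (msize (c *: g)) (msize g).
rewrite !(@diffop_bound k) ?leq_max ?leqnn ?orbT // scaler_sumr /=.
by apply: eq_bigr => m _; rewrite mcoeffZ scalerA.
Qed.

Lemma diffopX m f : diffop 'X_[m] f = f^`M[m].
Proof. by rewrite /diffop msuppX big_seq1 mcoeffX eqxx scale1r. Qed.

Lemma diffop0 f : diffop 0 f = 0. Proof. by rewrite /diffop msupp0 big_nil. Qed.

Lemma diffopN g f : diffop (- g) f = - diffop g f.
Proof. by rewrite -scaleN1r diffopZ scaleN1r. Qed.

Lemma diffop_sum (I : Type) (r : seq I) P (G : I -> {mpoly rat[n]}) f :
  diffop (\sum_(i <- r | P i) G i) f = \sum_(i <- r | P i) diffop (G i) f.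
Proof. by apply: (big_morph (diffop^~ f)) => [x y|]; rewrite ?diffopD ?diffop0. Qed.

Lemma diffop_linear g : linear (diffop g).
Proof.
move=> c f h; rewrite /diffop scaler_sumr -big_split /=; apply: eq_bigr => m _.
by rewrite linearP scalerDr !scalerA mulrC.
Qed.
HB.instance Definition _ g :=
  GRing.isLinear.Build rat {mpoly rat[n]} {mpoly rat[n]} _ (diffop g) (diffop_linear g).

Lemma diffopDr g f h :
  diffop g (f + h) = diffop g f + diffop g h. Proof. exact: linearD. Qed.
Lemma diffopZr g c f : diffop g (c *: f) = c *: diffop g f. Proof. exact: linearZ. Qed.
Lemma diffop0r g : diffop g 0 = 0. Proof. exact: linear0. Qed.

Lemma diffopM g h f : diffop (g * h) f = diffop g (diffop h f).
Proof.
elim/mpolyind: g => [|c m g _ _ IH]; first by rewrite mul0r !diffop0.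
rewrite mulrDl !diffopD IH; congr (_ + _); rewrite -scalerAl !diffopZ; congr (_ *: _).
elim/mpolyind: h {IH} => [|d m' h _ _ IH']; first by rewrite mulr0 !diffop0 diffop0r.
rewrite mulrDr !diffopD IH' diffopDr; congr (_ + _).
rewrite -scalerAr !diffopZ diffopZr; congr (_ *: _).
by rewrite -mpolyXD !diffopX addmC mderivmDm.
Qed.

Lemma diff_applyE (g : {mpoly int[n]}) f : diff_apply g f = diffop (map_mpoly intr g) f.
Proof.
rewrite /diff_apply /diffop (perm_big _ (msupp_map_mpoly _ (@intr_inj _))) /=.
by apply: eq_bigr => m _; rewrite mcoeff_map_mpoly.
Qed.

Definition monomial_qsym al s : {mpoly rat[n]} :=
  \sum_(m <- monomials_along al s) 'X_[m].

Lemma monomial_qsym_nil s : monomial_qsym [::] s = 1.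
Proof. by rewrite /monomial_qsym monomials_along_nil big_seq1 mpolyX0. Qed.

Lemma monomial_qsym_cons a al i s :
  monomial_qsym (a :: al) (i :: s) = monomial_qsym (a :: al) s + 'X_i ^+ a *
    monomial_qsym al s.
Proof.
rewrite /monomial_qsym /= big_cat big_map /=; congr (_ + _); rewrite mulr_sumr.
by apply: eq_bigr => m _; rewrite mpolyXD mpolyXn.
Qed.

Lemma diffop_monomial_qsym al s f :
  diffop (monomial_qsym al s) f = \sum_(m <- monomials_along al s) f^`M[m].
Proof. by rewrite diffop_sum; apply: eq_bigr => m _; rewrite diffopX. Qed.

(** The monomial quasisymmetric polynomials other than 1 span the
    quasisymmetric polynomials without constant term. *)
Lemma HQSymP f : HQSym n f <->
  (forall al, all (leq 1) al -> al != [::] -> diffop (monomial_qsym al (enum 'I_n)) f =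
    0).
Proof.
split=> [hf al hal al0|h g hg g0].
  pose g : {mpoly int[n]} := \sum_(m <- monomials_along al (enum 'I_n)) 'X_[m].
  have gE m : g@_m = (composition m == al)%:R.
    rewrite -(mem_monomials_enum _ hal) raddf_sum /=.
    under eq_bigr do rewrite mcoeffX.
    case: (boolP (m \in _)) => hm; last first.
      by rewrite big_seq big1 // => m' hm'; case: eqP hm => // <-; rewrite hm'.
    rewrite (bigD1_seq m) ?uniq_monomials_along ?enum_uniq //= eqxx big1 ?addr0 //.
    by move=> m' /negbTE ->.
  have := hf g; rewrite diff_applyE /=.
  have -> : map_mpoly intr g = monomial_qsym al (enum 'I_n).
    rewrite raddf_sum; apply: eq_bigr => m _; exact: map_mpolyX.
  apply; first by apply/QSym_composition => m m' e; rewrite !gE e.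
  by rewrite gE composition0 eq_sym (negbTE al0).
move/QSym_composition: hg => hg; rewrite /diff_apply.
pose T := undup (map (@composition n) (msupp g)).
have e (F : 'X_{1..n} -> {mpoly rat[n]}) : \sum_(m <- msupp g) F m =
    \sum_(al <- T) \sum_(m <- msupp g | composition m == al) F m.
  under [RHS]eq_bigr do rewrite big_mkcond /=.
  rewrite exchange_big /= big_seq [RHS]big_seq; apply: eq_bigr => m hm.
  rewrite (bigD1_seq (composition m)) ?undup_uniq ?mem_undup ?map_f //= eqxx.
  by rewrite big1 ?addr0 // => al; rewrite eq_sym => /negbTE ->.
rewrite e big_seq big1 // => al; rewrite mem_undup => /mapP[m0 hm0 ->].
have hp := composition_pos m0.
have -> : \sum_(m <- msupp g | composition m == composition m0) (g@_m)%:~R *: f^`M[m] =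
   (g@_m0)%:~R *: diffop (monomial_qsym (composition m0) (enum 'I_n)) f.
  rewrite diffop_monomial_qsym scaler_sumr -big_filter.
  rewrite (perm_big (monomials_along (composition m0) (enum 'I_n))) /=.
    rewrite big_seq [RHS]big_seq; apply: eq_bigr => m; rewrite mem_monomials_enum //.
    by move=> /eqP /hg ->.
  apply: uniq_perm;
    rewrite ?filter_uniq ?msupp_uniq ?uniq_monomials_along ?enum_uniq // => m.
  rewrite mem_filter mem_monomials_enum //; case: eqP => //= /hg.
  by rewrite !mcoeff_msupp => ->; rewrite -mcoeff_msupp.
rewrite h ?scaler0 //; apply/eqP => /composition_nil m00.
by move: hm0; rewrite mcoeff_msupp m00 g0 eqxx.
Qed.
End Action.

(** * Volume polynomials are quasisymmetric harmonics *)

Section Harmonic.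
Variable n : nat.
Implicit Types (s t : seq 'I_n) (m : 'X_{1..n}) (al : seq nat) (u v f g h : {mpoly
  rat[n]}).

(** The coproduct of quasisymmetric functions: a composition is cut between the
    variables of the two blocks. *)
Lemma monomial_qsym_cat al s t :
  monomial_qsym al (s ++ t) = \sum_(j < (size al).+1) monomial_qsym (take j al) s *
    monomial_qsym (drop j al) t :> {mpoly rat[n]}.
Proof.
elim: s al => [|i s IH] al /=.
  rewrite big_ord_recl take0 drop0 monomial_qsym_nil mul1r big1 ?addr0 // => j _.
  by case: al j => [[]//|a al] j /=; rewrite {1}/monomial_qsym big_nil mul0r.
case: al => [|a al]; first by rewrite big_ord1 /= !monomial_qsym_nil mulr1.
rewrite monomial_qsym_cons !IH big_ord_recl [in RHS]big_ord_recl /= !monomial_qsym_nil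
  -addrA; congr (_ + _).
rewrite mulr_sumr -big_split /=; apply: eq_bigr => j _.
by rewrite /= monomial_qsym_cons mulrDl mulrA.
Qed.

Lemma mderivm_indep m u v : (forall i, m i != 0%N -> u^`M(i) = 0) ->
  (u * v)^`M[m] = u * v^`M[m].
Proof.
move=> h; rewrite /mderivm; elim: (enum _) => //= i s ->.
have := h i; elim: (m i) => //= k IH hk.
by rewrite IH => [|_]; rewrite ?mderivM hk // mul0r add0r.
Qed.

Lemma diffop_qsym_indep al t u v : (forall i, i \in t -> u^`M(i) = 0) ->
  diffop (monomial_qsym al t) (u * v) = u * diffop (monomial_qsym al t) v.
Proof.
move=> h; rewrite !diffop_monomial_qsym mulr_sumr big_seq [RHS]big_seq.
apply: eq_bigr => m hm; apply: mderivm_indep => i;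
  case: (boolP (i \in t)) => [/h //|hi].
by rewrite (monomials_along_supp hm hi).
Qed.

Lemma mderiv_diffop g f i : (diffop g f)^`M(i) = diffop g (f^`M(i)).
Proof.
rewrite /diffop raddf_sum /=; apply: eq_bigr => m _; rewrite mderivZ; congr (_ *: _).
by rewrite -!mderivmU1m -!mderivmDm addmC.
Qed.

(** The Leibniz rule for factors in disjoint blocks of variables. *)
Lemma diffop_qsym_mul al s t u v : (forall i, i \in t -> u^`M(i) = 0) ->
  (forall i, i \in s -> v^`M(i) = 0) ->
  diffop (monomial_qsym al (s ++ t)) (u * v) =
  \sum_(j < (size al).+1) diffop (monomial_qsym (take j al) s) u *
    diffop (monomial_qsym (drop j al) t) v.
Proof.
move=> hu hv; rewrite monomial_qsym_cat diffop_sum; apply: eq_bigr => j _.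
rewrite diffopM diffop_qsym_indep // mulrC diffop_qsym_indep 1?mulrC // => i hi.
by rewrite mderiv_diffop hv // diffop0r.
Qed.

Definition var_block o k : seq 'I_n := pmap insub (iota o k).

Lemma var_block_add o k l : var_block o (k + l) = var_block o k ++ var_block (o + k) l.
Proof. by rewrite /var_block iotaD pmap_cat. Qed.

Lemma mem_var_block o k (i : 'I_n) : (i \in var_block o k) = (o <= i < o + k)%N.
Proof. by rewrite mem_pmap_sub mem_iota. Qed.

Lemma var_block_enum : var_block 0 n = enum 'I_n.
Proof. by rewrite enumT unlock. Qed.

(** Divided powers of the variables, with value 0 out of range. *)
Definition divpow (o k : nat) : {mpoly rat[n]} :=
  if insub o is Some i then (k`!%:R^-1 : rat) *: 'X_[U_(i : 'I_n) *+ k] else 0.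

Lemma divpow_ord (i : 'I_n) k : divpow i k = (k`!%:R^-1 : rat) *: 'X_[U_(i) *+ k].
Proof. by rewrite /divpow valK. Qed.

Lemma divpow_deriv (i j : 'I_n) k :
  (divpow i k)^`M(j) = if (i == j) && (0 < k)%N then divpow i k.-1 else 0.
Proof.
rewrite !divpow_ord mderivZ mderivX mulmnE mnm1E; case: eqP => [<-|_] /=; last first.
  by rewrite mul0n scale0r scaler0.
case: k => [|k] /=; first by rewrite muln0 scale0r scaler0.
rewrite mul1n scalerA; congr (_ *: 'X_[_]); last first.
  by rewrite mulmSr addmK.
by rewrite factS natrM invfM -mulrA mulrC -mulrA divff ?mulr1 ?pnatr_eq0.
Qed.

Lemma moment_indep (t : btree) o k (i : 'I_n) : ~~ (o <= i < o + nleaves t)%N ->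
  (moment divpow t o k)^`M(i) = 0.
Proof.
elim: t o k => [|l hl r hr] o k /= h.
  rewrite /divpow; case: insubP => [j hj ej|_]; last exact: linear0.
  have := divpow_deriv j i k; rewrite divpow_ord => ->; case: eqP => //= e.
  by move: h; rewrite -e ej; lia.
rewrite linearB /= !mderivM !(hl o, hr) ?mul0r ?mulr0 ?addr0 ?subr0 //; lia.
Qed.

(** The effect on a sequence of divided powers of one variable of the
    operators defined by the monomial quasisymmetric polynomials. *)
Definition word_shift al (e : nat -> {mpoly rat[n]}) (k : nat) : {mpoly rat[n]} :=
  match al with
  | [::] => e k
  | [:: a] => if (a <= k)%N then e (k - a)%N else 0
  | _ => 0
  end.

Lemma word_shift0 al e :
  all (leq 1) al -> word_shift al e 0 = if al is [::] then e 0%N else 0.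
Proof. by case: al => [|[|a] [|b al]]. Qed.

Lemma diffop_divpow al (i : 'I_n) k : all (leq 1) al ->
  diffop (monomial_qsym al [:: i]) (divpow i k) = word_shift al (divpow i) k.
Proof.
case: al => [_|a [|b al]] /=;
  first by rewrite monomial_qsym_nil -mpolyX0 diffopX mderivm0m.
  move=> _; rewrite monomial_qsym_cons monomial_qsym_nil mulr1 /monomial_qsym /=
    big_nil add0r mpolyXn diffopX.
  elim: a k => [|a IH] k; first by rewrite mderivn0 /= subn0.
  rewrite mderivSn divpow_deriv eqxx /=; case: k => [|k] /=; first by rewrite linear0.
  by rewrite IH ltnS subSS.
by move=> _; rewrite monomial_qsym_cons /monomial_qsym /= !big_nil mulr0 addr0 diffop0.
Qed.

(** M_alpha acts on the moments of a tree as on the divided powers of a single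
    variable.  In the Leibniz rule for a node, m_0 of one child is killed by
    every nonempty word, so only the terms where the whole word acts on the
    other child remain; if alpha = (k+1) the two remaining terms cancel. *)
Lemma diffop_moment al (t : btree) o k : all (leq 1) al -> (o + nleaves t <= n)%N ->
  diffop (monomial_qsym al (var_block o (nleaves t))) (moment divpow t o k) =
    word_shift al (moment divpow t o) k.
Proof.
move=> + hn; elim: t al o k hn => [|l hl r hr] al o k /= hn hal.
  have hon : (o < n)%N by lia.
  by rewrite /var_block /= insubT /= (diffop_divpow (Ordinal hon)).
rewrite var_block_add [diffop _ (_ - _)]linearB /=.
have hsl (i : 'I_n) : i \in var_block o (nleaves l) -> ~~ (o + nleaves l <= i < o +
  nleaves l + nleaves r)%N.
  by rewrite mem_var_block; lia.
have hsr (i : 'I_n) : i \in var_block (o + nleaves l) (nleaves r) -> ~~ (o <= i < o +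
  nleaves l)%N.
  by rewrite mem_var_block; lia.
rewrite !diffop_qsym_mul; first last.
- by move=> i /hsl /moment_indep.
- by move=> i /hsr /moment_indep.
- by move=> i /hsl /moment_indep.
- by move=> i /hsr /moment_indep.
have hat j : all (leq 1) (take j al) by move: hal;
  rewrite -{1}(cat_take_drop j al) all_cat => /andP[].
have had j : all (leq 1) (drop j al) by move: hal;
  rewrite -{1}(cat_take_drop j al) all_cat => /andP[].
rewrite (eq_bigr (fun j : 'I_(size al).+1 =>
  word_shift (take j al) (moment divpow l o) k.+1 *
   word_shift (drop j al) (moment divpow r (o + nleaves l)) 0)); last first.
  by move=> j _; rewrite hl ?hr //; lia.
rewrite [X in _ - X](eq_bigr (fun j : 'I_(size al).+1 =>
  word_shift (take j al) (moment divpow l o) 0 *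
   word_shift (drop j al) (moment divpow r (o + nleaves l)) k.+1)); last first.
  by move=> j _; rewrite hl ?hr //; lia.
rewrite big_ord_recr /= big1; last first.
  move=> [j hj] _; rewrite word_shift0 //=.
  by case e: (drop j al) => [|b be]; rewrite ?mulr0 //; have := size_drop j al;
    rewrite e /=; lia.
rewrite big_ord_recl /= big1; last first.
  move=> [j hj] _; rewrite word_shift0 //=.
  by rewrite /bump /=; case: (al) hj => [|b be] //=; rewrite mul0r.
rewrite add0r addr0 take_size drop_size take0 drop0 /=.
case: al hal {hat had} => [|a [|b al]] //= ha; last by rewrite mul0r mulr0 subrr.
case: (ltngtP a k.+1) => hk //=.
- by rewrite -ltnS hk subSn.
- by rewrite leqNgt (ltn_trans _ hk) //= mul0r mulr0 subrr.
by rewrite hk ltnn subnn subrr.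
Qed.

Lemma volume_prod_indep ts o (i : 'I_n) :
  (i < o)%N -> (volume_prod divpow ts o)^`M(i) = 0.
Proof.
elim: ts o => [|t ts IH] o h /=; first by rewrite -mpolyC1 mderivC.
by rewrite mderivM IH ?moment_indep ?mul0r ?mulr0 ?addr0 //; lia.
Qed.

Lemma diffop_volume_prod al ts o :
  all (leq 1) al -> (o + sumn (map nleaves ts) <= n)%N ->
  diffop (monomial_qsym al (var_block o (sumn (map nleaves ts)))) (volume_prod divpow
    ts o) =
  if al is [::] then volume_prod divpow ts o else 0.
Proof.
elim: ts al o => [|t ts IH] al o hal hn /=.
  case: al hal => [|a al] _;
    first by rewrite monomial_qsym_nil -mpolyX0 diffopX mderivm0m.
  by rewrite /var_block /= /monomial_qsym /= big_nil diffop0.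
rewrite /= in hn.
have hat j : all (leq 1) (take j al) by move: hal;
  rewrite -{1}(cat_take_drop j al) all_cat => /andP[].
have had j : all (leq 1) (drop j al) by move: hal;
  rewrite -{1}(cat_take_drop j al) all_cat => /andP[].
rewrite var_block_add diffop_qsym_mul; first last.
- by move=> i; rewrite mem_var_block => hi; apply: volume_prod_indep; lia.
- by move=> i; rewrite mem_var_block => hi; apply: moment_indep; lia.
rewrite (eq_bigr (fun j : 'I_(size al).+1 =>
  (if take j al is [::] then moment divpow t o 0 else 0) *
   (if drop j al is [::] then volume_prod divpow ts (o + nleaves t) else 0)));
     last first.
  by move=> [j hj] _ /=; rewrite diffop_moment ?word_shift0 ?IH //; lia.
case: al hal {hat had} => [|a al] _; first by rewrite big_ord1.
rewrite big1 // => [[[|j] hj]] _ /=; first by rewrite mulr0.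
by rewrite mul0r.
Qed.

Lemma volume_prod_HQSym ts :
  sumn (map nleaves ts) = n -> HQSym n (volume_prod divpow ts 0).
Proof.
move=> hs; apply/HQSymP => al hal al0; rewrite -var_block_enum.
have -> : var_block 0 n = var_block 0 (sumn (map nleaves ts)) by rewrite hs.
rewrite diffop_volume_prod ?hs //.
by case: al al0 {hal}.
Qed.
End Harmonic.

(** * Lexicographically least monomials *)

Section Lex.
Variable n : nat.
Implicit Types m : 'X_{1..n}.

Definition lexlt m m' : bool :=
  [exists k : 'I_n, (m k < m' k)%N && [forall i : 'I_n, (i < k)%N ==> (m i == m' i)]].

Lemma lexltP m m' : reflect
  (exists2 k : 'I_n, (m k < m' k)%N & forall i : 'I_n, (i < k)%N -> m i = m' i)
  (lexlt m m').
Proof.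
apply: (iffP existsP) => [[k /andP[h1 /forallP h2]]|[k h1 h2]]; exists k => //.
  by move=> i hi; have := h2 i; rewrite hi => /eqP.
by rewrite h1; apply/forallP => i; apply/implyP => /h2 ->.
Qed.

Lemma lexlt_irr m : lexlt m m = false.
Proof. by apply/lexltP => [[k]]; rewrite ltnn. Qed.

Lemma lexlt_trans : transitive lexlt.
Proof.
move=> m2 m1 m3 /lexltP[k hk ek] /lexltP[l hl el]; apply/lexltP.
case: (ltngtP k l) => h.
- by exists k => [|i hi]; [rewrite -el|rewrite ek // el // (ltn_trans hi)].
- by exists l => [|i hi]; [rewrite ek|rewrite ek ?el // (ltn_trans hi)].
move/val_inj: h => h; subst l; exists k => [|i hi]; last by rewrite ek ?el.
exact: ltn_trans hl.
Qed.

Lemma lexlt_total m m' : m != m' -> lexlt m m' || lexlt m' m.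
Proof.
move=> hne; have [i0 hi0] : exists i, m i != m' i.
  apply/existsP; rewrite -negb_forall; apply: contra hne => /forallP h.
  by apply/eqP/mnmP => i; apply/eqP.
pose k := [arg min_(i < i0 | m i != m' i) (i : nat)].
have [hk hmin] : m k != m' k /\ forall i : 'I_n, (i < k)%N -> m i = m' i.
  rewrite /k; case: arg_minnP => // j hj hmin; split=> // i hi.
  by apply/eqP/negPn/negP => /hmin; rewrite leqNgt hi.
case: (ltngtP (m k) (m' k)) hk => // h _; apply/orP; [left|right]; apply/lexltP;
  by exists k => // i /hmin.
Qed.

Lemma lexlt_add2l m m1 m2 : lexlt (m + m1) (m + m2) = lexlt m1 m2.
Proof.
apply/lexltP/lexltP => [] [k hk ek]; exists k => [|i /ek].
- by move: hk; rewrite !mnmDE ltn_add2l.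
- by rewrite !mnmDE; apply: addnI.
- by rewrite !mnmDE ltn_add2l.
by rewrite !mnmDE => ->.
Qed.

Lemma lexlt_add2r m m1 m2 : lexlt (m1 + m) (m2 + m) = lexlt m1 m2.
Proof. by rewrite ![(_ + m)%MM]addmC lexlt_add2l. Qed.

Lemma lex_seq_min (s : seq 'X_{1..n}) : s != [::] ->
  exists m, m \in s /\ forall m', m' \in s -> m' != m -> lexlt m m'.
Proof.
elim: s => // m [|m1 s] IH _.
  by exists m; rewrite inE; split=> // m'; rewrite inE => ->.
have [//|m0 [h0 hmin]] := IH.
have [e|hne] := eqVneq m m0.
  exists m; rewrite inE eqxx; split=> // m'; rewrite inE => /orP[->//|/hmin].
  by rewrite e.
case/orP: (lexlt_total hne) => h.
  exists m; rewrite inE eqxx; split=> // m'; rewrite inE => /orP[->//|/hmin hm' _].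
  by have [->//|/hm'] := eqVneq m' m0; apply: lexlt_trans.
exists m0; rewrite inE h0 orbT; split=> // m'; rewrite inE => /orP[/eqP->//|/hmin];
  exact.
Qed.

Variable K : idomainType.
Implicit Types p q : {mpoly K[n]}.

Definition lexmin p m :=
  m \in msupp p /\ forall m', m' \in msupp p -> m' != m -> lexlt m m'.

Lemma lexmin_exists p : p != 0 -> exists m, lexmin p m.
Proof. by rewrite -msupp_eq0 => /lex_seq_min. Qed.

Lemma lexmin_coef0 p m m' : lexmin p m -> lexlt m' m -> p@_m' = 0.
Proof.
move=> [hm hmin] h; apply/eqP; rewrite mcoeff_eq0; apply/negP => /hmin.
have [e|_ /(_ isT)/(lexlt_trans h)] := eqVneq m' m; first by rewrite e lexlt_irr in h.
by rewrite lexlt_irr.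
Qed.

Lemma lexminP p m : p@_m != 0 ->
  (forall m', p@_m' != 0 -> m' != m -> lexlt m m') -> lexmin p m.
Proof. by rewrite -mcoeff_msupp => h1 h2; split=> // m' ; rewrite mcoeff_msupp;
  apply: h2. Qed.

Lemma lexminM p q m1 m2 : lexmin p m1 -> lexmin q m2 -> lexmin (p * q) (m1 + m2)%MM.
Proof.
move=> [h1 min1] [h2 min2].
have key a b : a \in msupp p -> b \in msupp q -> (a + b)%MM != (m1 + m2)%MM ->
    lexlt (m1 + m2) (a + b).
  move=> /min1 ha /min2 hb.
  have [->|/ha la] := eqVneq a m1; first by rewrite eqm_add2l lexlt_add2l.
  have [->|/hb lb] := eqVneq b m2; first by rewrite lexlt_add2r la.
  by move=> _; apply: (@lexlt_trans (m1 + b)%MM); rewrite ?lexlt_add2l ?lexlt_add2r.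
apply: lexminP => [|m]; last first.
  rewrite -mcoeff_msupp => /msuppM_le /allpairsP[[a b] /= [ha hb ->]]; exact: key.
rewrite mpolyME raddf_sum /= big_allpairs /=.
rewrite (bigD1_seq m1) ?msupp_uniq //= (bigD1_seq m2) ?msupp_uniq //=.
rewrite mcoeffZ mcoeffX eqxx mulr1 big1_seq ?addr0; last first.
  by move=> b /andP[hne hb]; rewrite mcoeffZ mcoeffX eqm_add2l (negbTE hne) mulr0.
rewrite big1_seq ?addr0; first by rewrite mulf_neq0 // -mcoeff_msupp.
move=> a /andP[hne ha]; rewrite big1_seq // => b /andP[_ hb].
rewrite mcoeffZ mcoeffX; case: eqP => [e|]; last by rewrite mulr0.
have [eb|neb] := eqVneq b m2.
  by move: hne; rewrite -(inj_eq (@addIm _ m2)) -e eb eqxx.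
have : lexlt (m1 + m2) (a + b).
  apply: (@lexlt_trans (m1 + b)%MM); rewrite ?lexlt_add2l ?lexlt_add2r;
    [exact: min2|exact: min1].
by rewrite e lexlt_irr.
Qed.

Lemma lexminB p q m1 m2 :
  lexmin p m1 -> lexmin q m2 -> lexlt m2 m1 -> lexmin (p - q) m2.
Proof.
move=> hp hq h; have hp0 := lexmin_coef0 hp h; case: hp hq => h1 min1 [h2 min2].
apply: lexminP; first by rewrite mcoeffB hp0 sub0r oppr_eq0 -mcoeff_msupp.
move=> m; rewrite -mcoeff_msupp => /msuppB_le;
  rewrite mem_cat => /orP[/min1 hm _|/min2 //].
by have [->//|/hm] := eqVneq m m1; apply: lexlt_trans.
Qed.
End Lex.

(** * Least monomials of quasisymmetric harmonics *)

Definition incr_head (al : seq nat) := if al is a :: al' then a.+1 :: al' else [::].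

(** Prepends a part a+1, refined in all ways, to each word of L. *)
Fixpoint refs_head (a : nat) (L : seq (seq nat)) : seq (seq nat) :=
  if a is a'.+1 then
    map (cons 1%N) (refs_head a' L) ++ map incr_head (refs_head a' L)
  else map (cons 1%N) L.

Definition refinements (al : seq nat) : seq (seq nat) :=
  foldr (fun a L => refs_head a.-1 L) [:: [::]] al.

Lemma refs_headP a L : all (all (leq 1)) L ->
  all (fun be => (be != [::]) && all (leq 1) be) (refs_head a L).
Proof.
move=> hL; elim: a => [|a IH] /=; first by rewrite all_map; apply: sub_all hL.
rewrite all_cat !all_map; apply/andP; split; apply: sub_all IH => be /=.
  by case/andP.
by case: be => //= b be /andP[_ ->].
Qed.

Lemma refinementsP a al :
  all (fun be => (be != [::]) && all (leq 1) be) (refinements (a :: al)).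
Proof.
suff h be : all (all (leq 1)) (refinements be) by apply: refs_headP.
elim: be => // b be IH /=; apply: sub_all (refs_headP b.-1 IH) => ga.
by case/andP.
Qed.

Section Straightening.
Variable n : nat.
Implicit Types (s t : seq 'I_n) (m : 'X_{1..n}) (al : seq nat) (p q : {mpoly rat[n]}).

(** Gessel's fundamental quasisymmetric polynomial. *)
Definition fundamental_qsym al s : {mpoly rat[n]} :=
  \sum_(be <- refinements al) monomial_qsym be s.

Lemma fundamental_qsym_nil s : fundamental_qsym [::] s = 1.
Proof. by rewrite /fundamental_qsym big_seq1 monomial_qsym_nil. Qed.

Lemma fundamental_qsym_cons1 al i s : fundamental_qsym (1%N :: al) (i :: s) =
  fundamental_qsym (1%N :: al) s + 'X_i * fundamental_qsym al s.
Proof.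
rewrite /fundamental_qsym /= !big_map mulr_sumr -big_split /=; apply: eq_bigr => be _.
by rewrite monomial_qsym_cons.
Qed.

(** A monomial that involves the first variable contains one copy of it, and
    the rest of the first part may start again from the same variable. *)
Lemma fundamental_qsym_consS a al i s :
  fundamental_qsym (a.+2 :: al) (i :: s) = fundamental_qsym (a.+2 :: al) s + 'X_i *
    fundamental_qsym (a.+1 :: al) (i :: s).
Proof.
have /= hL := refinementsP a.+1 al.
rewrite /fundamental_qsym /= !big_cat !big_map /= mulr_sumr -!big_split /=.
rewrite big_seq [RHS]big_seq; apply: eq_bigr => be /(allP hL).
case: be => //= b be _; rewrite !monomial_qsym_cons expr1 [_ ^+ b.+1]exprS; ring.
Qed.

Definition supported (Q : 'X_{1..n} -> Prop) p := forall m, m \in msupp p -> Q m.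

Lemma supported0 Q : supported Q 0. Proof. by move=> m; rewrite msupp0. Qed.

Lemma supportedD Q p q : supported Q p -> supported Q q -> supported Q (p + q).
Proof. by move=> hp hq m /msuppD_le; rewrite mem_cat => /orP[/hp|/hq]. Qed.

Lemma supportedB Q p q : supported Q p -> supported Q q -> supported Q (p - q).
Proof. by move=> hp hq m /msuppB_le; rewrite mem_cat => /orP[/hp|/hq]. Qed.

Lemma supportedX (Q : 'X_{1..n} -> Prop) m : Q m -> supported Q 'X_[m].
Proof. by move=> hm m'; rewrite msuppX inE => /eqP ->. Qed.

Lemma supportedM (Q1 Q2 Q : 'X_{1..n} -> Prop) p q : supported Q1 p -> supported Q2 q ->
  (forall m1 m2, Q1 m1 -> Q2 m2 -> Q (m1 + m2)%MM) -> supported Q (p * q).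
Proof.
by move=> hp hq h m /msuppM_le /allpairsP[[a b] /= [/hp ha /hq hb ->]]; apply: h.
Qed.

Lemma supported_sum (I : eqType) (r : seq I) Q (G : I -> {mpoly rat[n]}) :
  (forall i, i \in r -> supported Q (G i)) -> supported Q (\sum_(i <- r) G i).
Proof.
move=> h; rewrite big_seq; elim/big_ind: _ => //; [exact: supported0|exact: supportedD].
Qed.

Lemma sub_supported (Q Q' : 'X_{1..n} -> Prop) p :
  (forall m, Q m -> Q' m) -> supported Q p -> supported Q' p.
Proof. by move=> h hp m /hp /h. Qed.

Lemma fundamental_qsym_supp al s :
  supported (fun m => forall i, i \notin s -> m i = 0%N) (fundamental_qsym al s).
Proof.
apply: supported_sum => be _; apply: supported_sum => m hm; apply: supportedX => i.
exact: monomials_along_supp hm.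
Qed.

(** The part of highest degree in the first variable. *)
Lemma fundamental_qsym_head b al i s : i \notin s ->
  supported (fun m => (m i <= b)%N /\ forall j, j \notin i :: s -> m j = 0%N)
    (fundamental_qsym (b.+1 :: al) (i :: s) - 'X_i ^+ b.+1 * fundamental_qsym al s).
Proof.
move=> his.
have hF be : supported (fun m => m i = 0%N /\ forall j, j \notin i :: s -> m j =
  0%N) (fundamental_qsym be s).
  apply: sub_supported (@fundamental_qsym_supp be s) => m h; split; first exact: h.
  by move=> j; rewrite inE negb_or => /andP[_ /h].
elim: b => [|b IH].
  rewrite fundamental_qsym_cons1 expr1 addrK;
    apply: sub_supported (hF _) => m [-> h] //.
rewrite fundamental_qsym_consS exprS -mulrA -addrA -mulrBr; apply: supportedD.
  by apply: sub_supported (hF _) => m [-> h].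
apply: supportedM (supportedX (erefl : (fun m => m = U_(i)%MM) _)) IH _ => m1 m2 ->
  [h1 h2]; split.
  by rewrite mnmDE mnm1E eqxx.
move=> j hj; rewrite mnmDE h2 // mnm1E; move: hj; rewrite inE negb_or eq_sym.
by case/andP=> /negbTE ->.
Qed.

(** The annihilator of the harmonics, which contains the ideal generated by the
    quasisymmetric polynomials without constant term. *)
Definition kills_harmonics p := forall f, HQSym n f -> diffop p f = 0.

Lemma killsB p q : kills_harmonics p -> kills_harmonics q -> kills_harmonics (p - q).
Proof. by move=> hp hq f hf; rewrite diffopD diffopN hp ?hq ?subrr. Qed.

Lemma killsM p q : kills_harmonics q -> kills_harmonics (p * q).
Proof. by move=> hq f hf; rewrite diffopM hq // diffop0r. Qed.

Lemma kills_fundamental_qsym a al :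
  kills_harmonics (fundamental_qsym (a :: al) (var_block n 0 n)).
Proof.
move=> f /HQSymP hf;
  rewrite var_block_enum /fundamental_qsym diffop_sum big_seq big1 // => be.
by move=> /(allP (refinementsP a al)) /andP[h1 h2]; apply: hf.
Qed.

Variable c : 'X_{1..n}.

(** m is lexicographically smaller than c, already on the first k variables. *)
Definition below k m := exists i : 'I_n,
  [/\ (i < k)%N, (m i < c i)%N & forall j : 'I_n, (j < i)%N -> m j = c j].

Definition truncation k : 'X_{1..n} :=
  [multinom if (i < k)%N then c i else 0%N | i < n].

Lemma truncationE k (i : 'I_n) : truncation k i = if (i < k)%N then c i else 0%N.
Proof. exact: mnmE. Qed.

Lemma belowW k l m : (k <= l)%N -> below k m -> below l m.
Proof. by move=> hkl [i [h1 h2 h3]]; exists i; split=> //; apply: leq_trans hkl. Qed.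

(** Multiplication by the variables of index at least k preserves [below k]. *)
Lemma below_add k m m' :
  below k m -> (forall i : 'I_n, (i < k)%N -> m' i = 0%N) -> below k (m + m')%MM.
Proof.
move=> [i [h1 h2 h3]] h; exists i; split=> //; first by rewrite mnmDE h // addn0.
by move=> j hj; rewrite mnmDE h ?h3 ?addn0 // (ltn_trans hj).
Qed.

Lemma var_block_cons k (hk : (k < n)%N) :
  var_block n k (n - k) = Ordinal hk :: var_block n k.+1 (n - k.+1).
Proof.
have -> : (n - k = 1 + (n - k.+1))%N by lia.
by rewrite var_block_add addn1 /var_block /= insubT.
Qed.

(** With w the first k letters of c, the ideal contains
      x^w F_al(x_k, ..., x_{n-1}) + (terms lexicographically below w)
    as soon as the word w al is not ballot; for k = n and al empty this is a
    polynomial with greatest monomial x^c.  If w is empty, F_al itself will do.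
    If w ends with b > 0, then x_k^b F_al is the part of highest degree in x_k of
    the polynomial of the shorter prefix and of the word b al.  If it ends with
    0, the recursion of the fundamental polynomials writes F_{a be} without x_k
    as F_{a be} with x_k, minus x_k F_{(a-1) be}: both shorter words are still
    not ballot.  The bound N is for an induction on the total length of the
    word, then on k. *)
Lemma straighten N k al : (k + size al <= N)%N -> (k <= n)%N -> all (leq 1) al ->
  ~~ ballot 0 (take k c ++ al) ->
  exists2 G, kills_harmonics G &
    supported (below k) (G - 'X_[truncation k] *
      fundamental_qsym al (var_block n k (n - k))).
Proof.
elim: N k al => [|N IHN] k al.
  by case: k al => [|k] [|a al] //=; rewrite take0.
elim: k al => [|k IHk] al hN hk hal.
  rewrite take0 subn0 /=; case: al hN hal => [|a al] //= hN hal hg.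
  exists (fundamental_qsym (a :: al) (var_block n 0 n));
    first exact: kills_fundamental_qsym.
  have -> : truncation 0 = 0%MM by apply/mnmP => i;
    apply: etrans (truncationE 0 i) (esym (mnm0E i)).
  by rewrite mpolyX0 mul1r subrr; apply: supported0.
pose i := Ordinal hk.
have hnotin : i \notin var_block n k.+1 (n - k.+1) by rewrite mem_var_block /=; lia.
have szc : size (c : seq nat) = n by rewrite size_tuple.
have htake : take k.+1 c = rcons (take k c) (c i).
  by rewrite (take_nth 0%N) ?szc // (mnm_nth 0%N).
have hpre : truncation k.+1 = (truncation k + U_(i) *+ c i)%MM.
  apply/mnmP => j; rewrite mnmDE !truncationE mulmnE mnm1E ltnS.
  case: (i =P j) => [<-|hij] /=; first by rewrite leqnn ltnn mul1n.
  have : val j <> k by move=> e; apply: hij; apply: val_inj.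
  by rewrite mul0n addn0; case: (ltngtP j k).
rewrite htake cat_rcons => hg.
case ec : (c i) => [|b].
  rewrite ec in hg.
  have hpre0 : truncation k.+1 = truncation k by rewrite hpre ec mulm0n addm0.
  case: al hN hal hg => [|a al] hN hal hg.
    have [||||G hG1 hG2] := IHk [::].
    - by move: hN => /=; lia.
    - exact: ltnW.
    - by [].
    - by apply: contra hg; rewrite cats0; apply: ballot_insert0_end.
    rewrite fundamental_qsym_nil mulr1 in hG2; exists G => //;
      rewrite hpre0 fundamental_qsym_nil mulr1.
    by apply: sub_supported hG2 => m; apply: belowW.
  case: a hN hal hg => [|a] //= hN hal hg.
  have hg1 : ~~ ballot 0 (take k c ++ a.+1 :: al).
    by apply: contra hg => h; apply: ballot_insert0; rewrite h.
  have hg2 : ~~ ballot 0 (take k c ++ a :: al).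
    by apply: contra hg => h; apply: ballot_insert0; rewrite h orbT.
  have [||||G1 hG1 hG1'] := IHN k (a.+1 :: al).
  - by move: hN => /=; lia.
  - exact: ltnW.
  - by [].
  - by [].
  rewrite var_block_cons -/i in hG1'.
  have [G2 hG2 hG2'] : exists2 G2, kills_harmonics G2 &
      supported (below k) (G2 * 'X_i - 'X_[truncation k] *
        (fundamental_qsym (a.+1 :: al) (i :: var_block n k.+1 (n - k.+1))
        - fundamental_qsym (a.+1 :: al) (var_block n k.+1 (n - k.+1)))).
    have Xlow p : supported (below k) p -> supported (below k) (p * 'X_i).
      move=> hp; apply: supportedM hp (supportedX (erefl : (fun m => m =
        U_(i)%MM) _)) _ => m1 m2 h ->.
      by apply: below_add => // j hj; rewrite mnm1E; case: (i =P j) => // e; move: hj;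
        rewrite -e ltnn.
    case: a hN hal hg hg1 hg2 {G1 hG1 hG1'} => [|a] hN hal hg hg1 hg2.
      (* The letter a - 1 is 0 = c_k, so the shorter word is read with the prefix
         of length k+1; the terms below that prefix are below the first k letters. *)
      have [||||G2 hG2 hG2'] := IHN k.+1 al.
      - by move: hN => /=; lia.
      - exact: hk.
      - by [].
      - by rewrite htake cat_rcons ec.
      exists G2 => //; rewrite fundamental_qsym_cons1 [_ + 'X_i *
        _ - _]addrAC subrr add0r.
      rewrite [_ * (_ * _)]mulrCA mulrC -mulrBr mulrC; apply: Xlow.
      rewrite hpre0 in hG2'; apply: sub_supported hG2' => m [j [h1 h2 h3]]; exists j;
        split=> //.
      move: h1; rewrite ltnS leq_eqVlt => /orP[/eqP e|//].
      have ej : j = i by apply: val_inj.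
      by move: h2; rewrite ej ec.
    have [||||G2 hG2 hG2'] := IHN k (a.+1 :: al).
    - by move: hN => /=; lia.
    - exact: ltnW.
    - by [].
    - by [].
    exists G2 => //; rewrite fundamental_qsym_consS [_ + 'X_i *
      _ - _]addrAC subrr add0r.
    rewrite [_ * (_ * _)]mulrCA mulrC -mulrBr mulrC; apply: Xlow.
    by rewrite var_block_cons in hG2'.
  exists (G1 - G2 * 'X_i).
    by apply: killsB => //; rewrite mulrC; apply: killsM.
  rewrite hpre0.
  have -> : G1 - G2 * 'X_i - 'X_[truncation k] *
    fundamental_qsym (a.+1 :: al) (var_block n k.+1 (n - k.+1)) =
    (G1 - 'X_[truncation k] * fundamental_qsym (a.+1 :: al) (i :: var_block n k.+1 (n -
      k.+1))) -
    (G2 * 'X_i - 'X_[truncation k] *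
      (fundamental_qsym (a.+1 :: al) (i :: var_block n k.+1 (n - k.+1))
        - fundamental_qsym (a.+1 :: al) (var_block n k.+1 (n - k.+1)))) by ring.
  by apply: sub_supported (supportedB hG1' hG2') => m; apply: belowW.
have [||||G hG hG'] := IHk (c i :: al).
- by move: hN => /=; lia.
- exact: ltnW.
- by rewrite /= ec hal.
- exact: hg.
exists G => //; rewrite var_block_cons -/i in hG'.
rewrite hpre mpolyXD -mpolyXn -mulrA.
set F' := fundamental_qsym al _; set F := fundamental_qsym (c i :: al) _ in hG'.
have -> : G - 'X_[truncation k] * ('X_i ^+ c i * F') = (G - 'X_[truncation k] * F) +
   'X_[truncation k] * (F - 'X_i ^+ c i * F') by ring.
apply: supportedD; first by apply: sub_supported hG' => m; apply: belowW.
have hX : supported (fun m => m = truncation k) 'X_[truncation k] by apply: supportedX.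
rewrite /F /F' ec; apply: supportedM hX (@fundamental_qsym_head b al _ _ hnotin) _ =>
  m1 m2 -> [h1 h2].
have h0 (j : 'I_n) : (j < k)%N -> m2 j = 0%N.
  by move=> hj; apply: h2; rewrite inE mem_var_block negb_or /=; apply/andP; split;
     [apply/eqP => e; move: hj; rewrite e ltnn|lia].
exists i; split=> //; first by rewrite mnmDE truncationE ltnn add0n ec.
by move=> j hj; rewrite mnmDE truncationE hj h0 // addn0.
Qed.
End Straightening.

(** If c were not ballot, the constant term of the operator of [straighten]
    applied to f would be c! times the coefficient of c in f, since f has no
    monomial below c. *)
Lemma HQSym_lexmin_ballot n (f : {mpoly rat[n]}) c :
  HQSym n f -> lexmin f c -> ballot 0 c.
Proof.
move=> hf hc; apply/negPn/negP => hg.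
have [||||G hG] := @straighten n c n n [::] => //.
- by rewrite addn0.
- by rewrite cats0 take_oversize ?size_tuple.
rewrite fundamental_qsym_nil mulr1; have -> : truncation c n = c by apply/mnmP => i;
  rewrite truncationE ltn_ord.
move=> hlow; have := hG f hf; rewrite -[G](subrK 'X_[c]) diffopD =>
  /(congr1 (mcoeff 0)).
rewrite mcoeffD mcoeff0 diffopX mcoeff_mderivm addm0 {1}/diffop raddf_sum /= big1_seq
  ?add0r.
  move/eqP; rewrite mulrn_eq0; case: hc; rewrite mcoeff_msupp => /negbTE -> _.
  rewrite orbF; apply/negP; rewrite -lt0n prodn_gt0 // => i.
  by rewrite ffactnn fact_gt0.
move=> m /andP[_ /hlow [i [_ h1 h2]]].
rewrite mcoeffZ mcoeff_mderivm addm0 (lexmin_coef0 hc) ?mul0rn ?mulr0 //.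
by apply/lexltP; exists i.
Qed.

(** * Integrals of nonnegative functions on the line *)

Section PolyIntegral.
Local Open Scope classical_set_scope.
Local Open Scope ring_scope.
Variable R : realType.
Notation mu := (@lebesgue_measure R).

Lemma integral_deriv_poly (p : {poly R}) a b : a <= b ->
  (\int[mu]_(x in `[a, b]) (p^`().[x])%:E = (p.[b] - p.[a])%:E)%E.
Proof.
rewrite le_eqVlt => /orP[/eqP ->|ab].
  by rewrite set_itv1 integral_set1 subrr.
rewrite (@continuous_FTC2 _ (fun x => p^`().[x]) (fun x => p.[x])) ?EFinB //.
- by apply: continuous_subspaceT => x; apply: continuous_horner.
- split.
  + by move=> x _; have [] := is_derive_poly p x.
  + by apply: cvg_at_right_filter; apply: continuous_horner.
  + by apply: cvg_at_left_filter; apply: continuous_horner.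
by move=> x _; rewrite derive1E; have [_ ->] := is_derive_poly p x.
Qed.


(** The functions for which integrals are additive and Tonelli applies. *)
Definition nonneg_meas d (T : measurableType d) (f : T -> R) :=
  measurable_fun setT f /\ forall x, 0 <= f x.

Notation Int f := (\int[mu]_x (f x)%:E)%E.

Lemma nonneg_measM d (T : measurableType d) (f g : T -> R) :
  nonneg_meas f -> nonneg_meas g -> nonneg_meas (fun x => f x * g x).
Proof.
move=> [mf f0] [mg g0]; split=> [|x]; last exact: mulr_ge0.
exact: measurable_funM.
Qed.

Lemma nonneg_meas_cst d (T : measurableType d) (a : R) :
  0 <= a -> nonneg_meas (fun _ : T => a).
Proof. by move=> a0; split. Qed.

Lemma nonneg_meas_le a : nonneg_meas (fun x : R => (x <= a)%R%:R : R).
Proof.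
split=> [|x]; last exact: ler0n.
apply: nonincreasing_measurable => // x y xy; rewrite ler_nat.
by case: (leP y a) => // ya; rewrite (le_trans xy ya).
Qed.

Lemma nonneg_meas_ge a : nonneg_meas (fun x : R => (a <= x)%R%:R : R).
Proof.
split=> [|x]; last exact: ler0n.
apply: nondecreasing_measurable => // x y xy; rewrite ler_nat.
by case: (leP a x) => // ya; rewrite (le_trans ya xy).
Qed.

Lemma nonneg_meas_lt a : nonneg_meas (fun x : R => (x < a)%R%:R : R).
Proof.
split=> [|x]; last exact: ler0n.
apply: nonincreasing_measurable => // x y xy; rewrite ler_nat.
by case: (ltP y a) => // ya; rewrite (le_lt_trans xy ya).
Qed.

Lemma nonneg_meas_ge_le a b : nonneg_meas (fun x : R => (a <= x <= b)%R%:R : R).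
Proof.
have -> : (fun x : R => (a <= x <= b)%R%:R : R) = (fun x => (a <= x)%R%:R *
  (x <= b)%R%:R).
  by apply/funext => x; rewrite -natrM mulnb.
exact: nonneg_measM (nonneg_meas_ge a) (nonneg_meas_le b).
Qed.

Lemma nonneg_meas_ge_lt a b : nonneg_meas (fun x : R => (a <= x < b)%R%:R : R).
Proof.
have -> : (fun x : R => (a <= x < b)%R%:R : R) = (fun x => (a <= x)%R%:R *
  (x < b)%R%:R).
  by apply/funext => x; rewrite -natrM mulnb.
exact: nonneg_measM (nonneg_meas_ge a) (nonneg_meas_lt b).
Qed.

Lemma nonneg_meas_comp d1 d2 (T1 : measurableType d1) (T2 : measurableType d2) (f : T2
  -> R) (g : T1 -> T2) :
  nonneg_meas f -> measurable_fun setT g -> nonneg_meas (fun x => f (g x)).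
Proof. by move=> [mf f0] mg; split=> [|x //]; apply: measurableT_comp. Qed.

Lemma nonneg_meas_le2 : nonneg_meas (fun z : R * R => (z.2 <= z.1)%R%:R : R).
Proof.
have -> : (fun z : R * R => (z.2 <= z.1)%R%:R : R) = (fun z => (0 <= z.1 - z.2)%R%:R).
  by apply/funext => z; rewrite subr_ge0.
by apply: (nonneg_meas_comp (nonneg_meas_ge 0)); apply: measurable_funB.
Qed.

Lemma nonneg_measE d (T : measurableType d) (f : T -> R) :
  nonneg_meas f -> measurable_fun setT (fun x => (f x)%:E).
Proof. by move=> [mf _]; apply/measurable_EFinP. Qed.

Lemma IntD f g :
  nonneg_meas f -> nonneg_meas g -> Int (fun x => f x + g x) = (Int f + Int g)%E.
Proof.
move=> nf ng; rewrite -ge0_integralD //.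
- by move=> x _; rewrite lee_fin; case: nf.
- exact: nonneg_measE.
- by move=> x _; rewrite lee_fin; case: ng.
- exact: nonneg_measE.
Qed.

Lemma IntZ k f : 0 <= k -> nonneg_meas f -> Int (fun x => k * f x) = (k%:E * Int f)%E.
Proof.
move=> k0 nf; rewrite -ge0_integralZl //.
- exact: nonneg_measE.
- by move=> x _; rewrite lee_fin; case: nf.
Qed.

Lemma Int_le f g :
  nonneg_meas f -> nonneg_meas g -> (forall x, f x <= g x) -> (Int f <= Int g)%E.
Proof.
move=> nf ng fg; apply: ge0_le_integral => //.
- by move=> x _; rewrite lee_fin; case: nf.
- exact: nonneg_measE.
- exact: nonneg_measE.
- by move=> x _; rewrite lee_fin.
Qed.

Lemma Int_ge0 f : nonneg_meas f -> (0 <= Int f)%E.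
Proof. by move=> [_ f0]; apply: integral_ge0 => x _; rewrite lee_fin. Qed.

Lemma Int_fubini (g : R * R -> R) : nonneg_meas g ->
  (\int[mu]_x Int (fun y => g (x, y)) = \int[mu]_y Int (fun x => g (x, y)))%E.
Proof.
move=> ng; apply: (@fubini_tonelli _ _ _ _ _ mu mu (fun z => (g z)%:E)).
  exact: nonneg_measE.
by move=> z; rewrite lee_fin; case: ng.
Qed.

Lemma Int_itv (i : interval R) f :
  Int (fun x => (x \in i)%:R * f x) = (\int[mu]_(x in [set` i]) (f x)%:E)%E.
Proof.
rewrite [RHS]integral_mkcond; apply: eq_integral => x _.
rewrite patchE mem_setE; case: (x \in i); first by rewrite mul1r.
by rewrite mul0r.
Qed.

Variable c : R.
(** Divided powers of x - c, cut off below c so as to be nonnegative. *)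
Definition cut_divpow k x : R := (c <= x)%R%:R * ((x - c) ^+ k / k`!%:R).

Lemma cut_divpow_ge0 k x : 0 <= cut_divpow k x.
Proof.
rewrite /cut_divpow; case: (leP c x) => h; last by rewrite mul0r.
by rewrite mul1r divr_ge0 ?ler0n // exprn_ge0 // subr_ge0.
Qed.

Lemma cut_divpow0 x : c <= x -> cut_divpow 0 x = 1.
Proof. by rewrite /cut_divpow => ->; rewrite expr0 mul1r divr1. Qed.

Let P k : {poly R} := (k`!%:R)^-1 *: ('X - c%:P) ^+ k.

Let PE k x : (P k).[x] = (x - c) ^+ k / k`!%:R.
Proof. by rewrite /P hornerZ horner_exp hornerXsubC mulrC. Qed.

Let P_deriv k : (P k.+1)^`() = P k.
Proof.
rewrite /P derivZ deriv_exp /= derivXsubC mul1r -scalerMnr scalerMnl; congr (_ *: _).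
rewrite -[LHS]mulr_natr factS natrM invfM mulrAC mulVf ?mul1r //.
Qed.

Lemma nonneg_meas_cut_divpow k : nonneg_meas (cut_divpow k).
Proof.
split; last exact: cut_divpow_ge0.
apply: measurable_funM; first by case: (nonneg_meas_ge c).
have -> : (fun x => (x - c) ^+ k / k`!%:R) = horner (P k) by apply/funext => x;
  rewrite PE.
exact: (continuous_measurable_fun (@continuous_horner R (P k))).
Qed.

Lemma Int_cut_divpow k a b : c <= a -> a <= b ->
  Int (fun y => (a <= y <= b)%R%:R * cut_divpow k y) =
    (cut_divpow k.+1 b - cut_divpow k.+1 a)%:E.
Proof.
move=> ca ab.
have -> : (fun y => ((a <= y <= b)%R%:R * cut_divpow k y)%:E) =
  (fun y => ((y \in `[a, b])%:R * (P k).[y])%:E).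
  apply/funext => y; rewrite in_itv /= PE /cut_divpow.
  by case: (leP a y) => /= h; rewrite ?mul0r // (le_trans ca h) mul1r.
rewrite Int_itv -(P_deriv k) integral_deriv_poly // !PE /cut_divpow ca (le_trans ca ab)
  !mul1r //.
Qed.

Lemma Int_cut_divpow_lt k a b : c <= a -> a <= b ->
  Int (fun y => (a <= y < b)%R%:R * cut_divpow k y) =
    (cut_divpow k.+1 b - cut_divpow k.+1 a)%:E.
Proof.
move=> ca ab.
have -> : (fun y => ((a <= y < b)%R%:R * cut_divpow k y)%:E) =
  (fun y => ((y \in `[a, b[)%:R * (P k).[y])%:E).
  apply/funext => y; rewrite in_itv /= PE /cut_divpow.
  by case: (leP a y) => /= h; rewrite ?mul0r // (le_trans ca h) mul1r.
rewrite Int_itv integral_itv_bndo_bndc.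
  rewrite -(P_deriv k) integral_deriv_poly // !PE /cut_divpow ca (le_trans ca ab)
    !mul1r //.
apply/measurable_EFinP/measurable_funTS.
exact: (continuous_measurable_fun (@continuous_horner R (P k))).
Qed.

(** Write T(y) as the integral of d over x >= y and integrate first in y: this
    trades the tail T for d, at the cost of raising k. *)
Lemma moment_tail k p (d T : R -> R) : c <= p -> nonneg_meas d -> nonneg_meas T ->
  (forall y, (T y)%:E = Int (fun x => (y <= x)%R%:R * d x)) ->
  (Int (fun y => (p <= y)%R%:R * cut_divpow k y * T y) + (cut_divpow k.+1 p)%:E *
    Int (fun x => (p <= x)%R%:R * d x) =
   Int (fun x => (p <= x)%R%:R * (cut_divpow k.+1 x * d x)))%E.
Proof.
move=> cp nd nT hT.
pose g (z : R * R) : R := ((p <= z.2)%R%:R * cut_divpow k z.2) * ((z.2 <= z.1)%R%:R *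
  d z.1).
have ng : nonneg_meas g.
  apply: nonneg_measM; first apply: nonneg_measM.
  - by apply: (nonneg_meas_comp (nonneg_meas_ge p)).
  - by apply: (nonneg_meas_comp (nonneg_meas_cut_divpow k)).
  apply: nonneg_measM; first exact: nonneg_meas_le2.
  by apply: (nonneg_meas_comp nd).
have nD y : nonneg_meas (fun x : R => (y <= x)%R%:R * d x) by apply: nonneg_measM =>
  //; apply: nonneg_meas_ge.
have -> : Int (fun y => (p <= y)%R%:R * cut_divpow k y * T y) =
    (\int[mu]_x Int (fun y => g (x, y)))%E.
  apply: etrans (esym (Int_fubini ng)).
  apply: eq_integral => y _; rewrite EFinM hT -(IntZ _ (nD y)) //.
  by apply: mulr_ge0; [apply: ler0n|apply: cut_divpow_ge0].
have ndw : nonneg_meas (fun x : R => (p <= x)%R%:R *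
  ((cut_divpow k.+1 x - cut_divpow k.+1 p) * d x)).
  split; last first.
    move=> x; case: (leP p x) => px; last by rewrite mul0r.
    rewrite mul1r mulr_ge0 //; last by case: nd.
    by rewrite subr_ge0 /cut_divpow cp (le_trans cp px) !mul1r ler_pM2r ?invr_gt0
      ?ltr0n ?fact_gt0 //
      lerXn2r ?nnegrE ?subr_ge0 ?(le_trans cp) // lerB.
  apply: measurable_funM; first by case: (nonneg_meas_ge p).
  apply: measurable_funM; last by case: nd.
  by apply: measurable_funB => //; case: (nonneg_meas_cut_divpow k.+1).
have -> : (\int[mu]_x Int (fun y => g (x, y)))%E =
   Int (fun x => (p <= x)%R%:R * ((cut_divpow k.+1 x - cut_divpow k.+1 p) * d x)).
  apply: eq_integral => x _; rewrite /g /=; case: (leP p x) => px.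
    rewrite mul1r EFinM -Int_cut_divpow // muleC.
    rewrite -(IntZ _ (nonneg_measM (nonneg_meas_ge_le p x) (nonneg_meas_cut_divpow
      k))); last by case: nd.
    apply: eq_integral => y _; congr EFin.
    by case: (p <= y); case: (y <= x); rewrite /= ?mul1r ?mul0r ?mulr0 // mulrC.
  rewrite mul0r; apply: integral0_eq => y _; congr EFin.
  case: (leP p y) => py; last by rewrite !mul0r.
  by rewrite leNgt (lt_le_trans px py) /= mul0r mulr0.
rewrite -(IntZ (cut_divpow_ge0 _ _) (nD p)) -(IntD ndw (nonneg_measM (nonneg_meas_cst _
  (cut_divpow_ge0 _ _)) (nD p))).
by apply: eq_integral => x _; congr EFin; ring.
Qed.

(** The same for the distribution function.  The inequality y < p is strict so
    that y < p and p <= y partition the line in the recursion on trees. *)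
Lemma moment_head k p (d T : R -> R) : c <= p -> nonneg_meas d -> nonneg_meas T ->
  (forall x, x < c -> d x = 0) ->
  (forall y, (T y)%:E = Int (fun x => (x <= y)%R%:R * d x)) ->
  (Int (fun y => (y < p)%R%:R * cut_divpow k y * T y) + Int (fun x => (x < p)%R%:R *
    (cut_divpow k.+1 x * d x)) =
   (cut_divpow k.+1 p)%:E * Int (fun x => (x < p)%R%:R * d x))%E.
Proof.
move=> cp nd nT d0 hT.
pose g (z : R * R) : R := ((z.2 < p)%R%:R * cut_divpow k z.2) * ((z.1 <= z.2)%R%:R *
  d z.1).
have ng : nonneg_meas g.
  apply: nonneg_measM; first apply: nonneg_measM.
  - by apply: (nonneg_meas_comp (nonneg_meas_lt p)).
  - by apply: (nonneg_meas_comp (nonneg_meas_cut_divpow k)).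
  apply: nonneg_measM; last by apply: (nonneg_meas_comp nd).
  apply: (nonneg_meas_comp nonneg_meas_le2 (g := fun z => (z.2, z.1))).
  exact: measurable_swap.
have nD y : nonneg_meas (fun x : R => (x <= y)%R%:R * d x) by apply: nonneg_measM =>
  //; apply: nonneg_meas_le.
have nDp : nonneg_meas (fun x : R => (x < p)%R%:R * d x) by apply: nonneg_measM => //;
  apply: nonneg_meas_lt.
have -> : Int (fun y => (y < p)%R%:R * cut_divpow k y * T y) =
    (\int[mu]_x Int (fun y => g (x, y)))%E.
  apply: etrans (esym (Int_fubini ng)).
  apply: eq_integral => y _; rewrite EFinM hT -(IntZ _ (nD y)) //.
  by apply: mulr_ge0; [apply: ler0n|apply: cut_divpow_ge0].
have ndw : nonneg_meas (fun x : R => (x < p)%R%:R *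
  ((cut_divpow k.+1 p - cut_divpow k.+1 x) * d x)).
  split; last first.
    move=> x; case: (ltP x p) => px; last by rewrite mul0r.
    rewrite mul1r; case: (ltP x c) => [/d0 ->|cx]; first by rewrite mulr0.
    rewrite mulr_ge0 //; last by case: nd.
    by rewrite subr_ge0 /cut_divpow cp cx !mul1r ler_pM2r ?invr_gt0 ?ltr0n ?fact_gt0 //
      lerXn2r ?nnegrE ?subr_ge0 // lerB // ltW.
  apply: measurable_funM; first by case: (nonneg_meas_lt p).
  apply: measurable_funM; last by case: nd.
  by apply: measurable_funB => //; case: (nonneg_meas_cut_divpow k.+1).
have -> : (\int[mu]_x Int (fun y => g (x, y)))%E =
   Int (fun x => (x < p)%R%:R * ((cut_divpow k.+1 p - cut_divpow k.+1 x) * d x)).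
  apply: eq_integral => x _; rewrite /g /=; case: (ltP x p) => px.
    case: (ltP x c) => [/d0 ->|cx].
      by rewrite !mulr0; apply: integral0_eq => y _; rewrite !mulr0.
    rewrite mul1r EFinM -Int_cut_divpow_lt //; last exact: ltW.
    rewrite muleC -(IntZ _ (nonneg_measM (nonneg_meas_ge_lt x p)
      (nonneg_meas_cut_divpow k))); last by case: nd.
    apply: eq_integral => y _; congr EFin.
    by case: (y < p); case: (x <= y); rewrite /= ?mul1r ?mul0r ?mulr0 // mulrC.
  rewrite mul0r; apply: integral0_eq => y _; congr EFin.
  case: (ltP y p) => py; last by rewrite !mul0r.
  by rewrite leNgt (lt_le_trans py px) /= mul0r mulr0.
rewrite -(IntZ (cut_divpow_ge0 _ _) nDp) -(IntD ndw (nonneg_measM (nonneg_meas_lt p)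
  (nonneg_measM (nonneg_meas_cut_divpow k.+1) nd))).
by apply: eq_integral => x _; congr EFin; ring.
Qed.

End PolyIntegral.

(** * The distribution of the root value of a tree *)

Section TreeDensity.
Local Open Scope classical_set_scope.
Local Open Scope ring_scope.
Variable R : realType.
Notation mu := (@lebesgue_measure R).
Notation Int f := (\int[mu]_x (f x)%:E)%E.

Lemma Int_lt_le (p : R) (f : R -> R) : nonneg_meas f ->
  Int (fun x => (x < p)%R%:R * f x) = Int (fun x => (x <= p)%R%:R * f x).
Proof.
move=> nf; have := Int_itv `]-oo, p[ f; have := Int_itv `]-oo, p] f.
rewrite -integral_itv_bndo_bndc; last by apply: measurable_funTS; exact: nonneg_measE.
move=> <- h; apply: etrans (etrans h _); apply: eq_integral => x _;
  by rewrite in_itv.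
Qed.

Variables (lam : nat -> R) (c C : R).
Hypothesis cC : c <= C.

(** The volumes of the parts of the polytope of t where the value at the root
    is at least y, resp. at most y.  For a node, the density of the value y at
    the root is the product of the volumes of the left polytope with root >= y
    and of the right polytope with root <= y.  The cut to [c, C] is
    harmless if all leaf values lie there, and makes every integral finite. *)
Fixpoint masses (t : btree) (o : nat) : (R -> R) * (R -> R) :=
  match t with
  | Leaf => (fun y => (y <= lam o)%R%:R, fun y => (lam o <= y)%R%:R)
  | Node l r =>
    let d x := (c <= x <= C)%R%:R * ((masses l o).1 x * (masses r (o +
      nleaves l)).2 x) in
    (fun y => fine (Int (fun x => (y <= x)%R%:R * d x)),
     fun y => fine (Int (fun x => (x <= y)%R%:R * d x)))
  end.

Definition upper_mass t o := (masses t o).1.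
Definition lower_mass t o := (masses t o).2.
Definition root_density l r o (x : R) : R :=
  (c <= x <= C)%R%:R * (upper_mass l o x * lower_mass r (o + nleaves l) x).

Lemma Int_itv_fin (K : R) (d : R -> R) :
  nonneg_meas d -> (forall x, d x <= (c <= x <= C)%R%:R * K) ->
  Int d \is a fin_num.
Proof.
move=> nd dK; have K0 : 0 <= K.
  have := dK c; rewrite lexx cC mul1r; apply: le_trans; by case: nd.
rewrite ge0_fin_numE ?Int_ge0 //.
apply: (@le_lt_trans _ _ (Int (fun x => K * ((c <= x <= C)%R%:R * cut_divpow c 0 x)))).
  apply: Int_le => //;
    first exact: nonneg_measM (nonneg_meas_cst _ K0) (nonneg_measM (nonneg_meas_ge_le c
    C) (nonneg_meas_cut_divpow c 0)).
  move=> x; apply: le_trans (dK x) _; case: (leP c x) => cx /=;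
    last by rewrite !mul0r mulr0.
  by rewrite cut_divpow0 // mulr1 mulrC.
rewrite (IntZ K0 (nonneg_measM (nonneg_meas_ge_le c C) (nonneg_meas_cut_divpow c 0)))
  Int_cut_divpow //.
by rewrite -EFinM ltry.
Qed.

Lemma masses_bounded t o :
  [/\ nonneg_meas (upper_mass t o), nonneg_meas (lower_mass t o), exists K, forall x,
    upper_mass t o x <= K & exists K, forall x, lower_mass t o x <= K].
Proof.
elim: t o => [|l hl r hr] o.
  split; [exact: nonneg_meas_le|exact: nonneg_meas_ge| |]; exists 1 => x;
    rewrite /upper_mass /lower_mass /=;
  by rewrite lern1 leq_b1.
have [nl _ [K1 h1] _] := hl o; have [_ nr _ [K2 h2]] := hr (o + nleaves l)%N.
have nd : nonneg_meas (root_density l r o) by apply: nonneg_measM (nonneg_meas_ge_le c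
  C) (nonneg_measM nl nr).
have hdens x : root_density l r o x <= (c <= x <= C)%R%:R * (K1 * K2).
  rewrite /root_density; apply: ler_wpM2l; first exact: ler0n.
  by apply: ler_pM => //; [case: nl|case: nr].
have K0 : 0 <= K1 * K2.
  have := hdens c; rewrite lexx cC mul1r; apply: le_trans; by case: nd.
have finI (b : R -> bool) : nonneg_meas (fun x : R => (b x)%:R : R) -> Int (fun x =>
  (b x)%:R * root_density l r o x) \is a fin_num.
  move=> nb; apply: (@Int_itv_fin (K1 * K2)); first exact: nonneg_measM.
  move=> x; apply: le_trans (hdens x); case: (b x); first by rewrite mul1r.
  by rewrite mul0r; case: nd.
have I0 (b : R -> bool) : nonneg_meas (fun x : R => (b x)%:R : R) ->
    0 <= fine (Int (fun x => (b x)%:R * root_density l r o x)).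
  by move=> nb; apply: fine_ge0; apply: Int_ge0; exact: nonneg_measM.
have Ile (b b' : R -> bool) : nonneg_meas (fun x : R => (b x)%:R : R) ->
  nonneg_meas (fun x : R => (b' x)%:R : R) ->
    (forall x, b x -> b' x) ->
    fine (Int (fun x => (b x)%:R * root_density l r o x)) <= fine (Int (fun x =>
      (b' x)%:R * root_density l r o x)).
  move=> nb nb' bb'; apply: fine_le; rewrite ?finI //.
  apply: Int_le; [exact: nonneg_measM|exact: nonneg_measM|move=> x].
  apply: ler_wpM2r; first by case: nd.
  by rewrite ler_nat; case: (b x) (bb' x) => // ->.
have nT : nonneg_meas (fun x : R =>
  (xpredT x)%:R : R) by exact: (nonneg_meas_cst _ ler01).
have Itl y : upper_mass (Node l r) o y = fine (Int (fun x => (y <= x)%R%:R *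
  root_density l r o x)) by [].
have Ihd y : lower_mass (Node l r) o y = fine (Int (fun x => (x <= y)%R%:R *
  root_density l r o x)) by [].
split.
- split; last by move=> y; rewrite Itl; apply: I0; exact: nonneg_meas_ge.
  apply: nonincreasing_measurable => // x y xy; rewrite !Itl; apply: Ile;
    try exact: nonneg_meas_ge.
  by move=> z; apply: le_trans.
- split; last by move=> y; rewrite Ihd; apply: I0; exact: nonneg_meas_le.
  apply: nondecreasing_measurable => // x y xy; rewrite !Ihd; apply: Ile;
    try exact: nonneg_meas_le.
  by move=> z zx; apply: le_trans zx xy.
- exists (fine (Int (fun x => (xpredT x)%:R * root_density l r o x))) => y.
  by rewrite Itl; apply: Ile => //; exact: nonneg_meas_ge.
- exists (fine (Int (fun x => (xpredT x)%:R * root_density l r o x))) => y.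
  by rewrite Ihd; apply: Ile => //; exact: nonneg_meas_le.
Qed.

Lemma nonneg_meas_upper t o :
  nonneg_meas (upper_mass t o). Proof. by case: (masses_bounded t o). Qed.
Lemma nonneg_meas_lower t o :
  nonneg_meas (lower_mass t o). Proof. by case: (masses_bounded t o). Qed.
Lemma nonneg_meas_density l r o : nonneg_meas (root_density l r o).
Proof. exact: nonneg_measM (nonneg_meas_ge_le c C) (nonneg_measM (nonneg_meas_upper l
  o) (nonneg_meas_lower r _)). Qed.

Lemma root_density_fin l r o (b : R -> bool) :
  nonneg_meas (fun x : R => (b x)%:R : R) ->
  Int (fun x => (b x)%:R * root_density l r o x) \is a fin_num.
Proof.
move=> nb; have [nl _ [K1 h1] _] := masses_bounded l o.
have [_ nr _ [K2 h2]] := masses_bounded r (o + nleaves l)%N.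
apply: (@Int_itv_fin (K1 * K2));
  first exact: nonneg_measM nb (nonneg_meas_density l r o).
move=> x; have hdens : root_density l r o x <= (c <= x <= C)%R%:R * (K1 * K2).
  rewrite /root_density; apply: ler_wpM2l; first exact: ler0n.
  by apply: ler_pM => //; [case: nl|case: nr].
apply: le_trans hdens; case: (b x); first by rewrite mul1r.
by rewrite mul0r; case: (nonneg_meas_density l r o).
Qed.

Lemma upper_mass_node l r o y :
  (upper_mass (Node l r) o y)%:E = Int (fun x => (y <= x)%R%:R * root_density l r o x).
Proof. by rewrite /upper_mass /= fineK //; apply: root_density_fin;
  exact: nonneg_meas_ge. Qed.

Lemma lower_mass_node l r o y :
  (lower_mass (Node l r) o y)%:E = Int (fun x => (x <= y)%R%:R * root_density l r o x).
Proof. by rewrite /lower_mass /= fineK //; apply: root_density_fin;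
  exact: nonneg_meas_le. Qed.

Lemma root_density_lt l r o x : x < c -> root_density l r o x = 0.
Proof. by rewrite /root_density ltNge => /negbTE ->; rewrite mul0r. Qed.

Lemma upper_mass0 t o y :
  (forall q, (o <= q < o + nleaves t)%N -> lam q < y) -> upper_mass t o y = 0.
Proof.
elim: t o y => [|l hl r _] o y h.
  by rewrite /upper_mass /= leNgt h //=; lia.
have h' q : (o <= q < o + nleaves l)%N -> lam q < y.
  by move=> hq; apply: h => /=; lia.
apply: EFin_inj; rewrite upper_mass_node; apply: integral0_eq => x _; congr EFin.
case: (leP y x) => yx; last by rewrite mul0r.
rewrite /root_density (hl o) ?mul0r ?mulr0 // => q /h' hq; exact: lt_le_trans hq yx.
Qed.

Lemma lower_mass0 t o y :
  (forall q, (o <= q < o + nleaves t)%N -> y < lam q) -> lower_mass t o y = 0.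
Proof.
elim: t o y => [|l _ r hr] o y h.
  by rewrite /lower_mass /= leNgt h //=; lia.
have h' q : (o + nleaves l <= q < o + nleaves l + nleaves r)%N -> y < lam q.
  by move=> hq; apply: h => /=; lia.
apply: EFin_inj; rewrite lower_mass_node; apply: integral0_eq => x _; congr EFin.
case: (leP x y) => yx; last by rewrite mul0r.
rewrite /root_density (hr (o + nleaves l)%N) ?mulr0 // => q /h' hq;
  exact: le_lt_trans yx hq.
Qed.

Hypothesis lam_dec : forall i, lam i.+1 <= lam i.

Lemma lam_anti i j : (i <= j)%N -> lam j <= lam i.
Proof.
move=> /subnK <-; elim: (j - i)%N => // k IH; rewrite addSn;
  exact: le_trans (lam_dec _) IH.
Qed.

Notation E := (moment (fun p k => cut_divpow c k (lam p))).

(** The recursion of [moment] holds for the root density.  At the first leaf p0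
    of the right subtree the density splits: to the right of p0 the lower mass
    of r is constant, to the left of p0 the upper mass of l is constant.  So a
    moment of the density is a combination of a moment of the upper mass of l
    over [p0, +oo[ and of one of the lower mass of r over ]-oo, p0[, and these
    are moments of the densities of l and r by [moment_tail], [moment_head]. *)
Lemma tree_moments t o :
  (forall q, (o <= q < o + nleaves t)%N -> c <= lam q <= C) ->
  [/\ forall k p, c <= p -> (forall q, (o <= q < o + nleaves t)%N -> p <= lam q) ->
        (Int (fun y => (p <= y)%R%:R * cut_divpow c k y * upper_mass t o y) +
          (cut_divpow c k.+1 p * E t o 0)%:E =
         (E t o k.+1)%:E)%E,
      forall k p, c <= p -> (forall q, (o <= q < o + nleaves t)%N -> lam q <= p) ->
        (Int (fun y => (y < p)%R%:R * cut_divpow c k y * lower_mass t o y) +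
          (E t o k.+1)%:E =
         (cut_divpow c k.+1 p * E t o 0)%:E)%E,
      forall y, c <= y -> (forall q, (o <= q < o + nleaves t)%N -> y <= lam q) ->
        upper_mass t o y = E t o 0 &
      forall y, (forall q, (o <= q < o + nleaves t)%N -> lam q <= y) ->
        lower_mass t o y = E t o 0 ].
Proof.
elim: t o => [|l hl r hr] o hb.
  have ho : c <= lam o <= C by apply: hb => /=; lia.
  case/andP: ho => co oC.
  rewrite /upper_mass /lower_mass /= cut_divpow0 //; split.
  - move=> k p cp h; have po : p <= lam o by apply: h; lia.
    rewrite mulr1 -[in RHS](subrK (cut_divpow c k.+1 p) (cut_divpow c k.+1 _)) EFinD;
      congr (_ + _)%E.
    rewrite -Int_cut_divpow //; apply: eq_integral => y _; congr EFin.
    by rewrite mulrAC -natrM mulnb.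
  - move=> k p cp h; have po : lam o <= p by apply: h; lia.
    rewrite mulr1 -[in RHS](subrK (cut_divpow c k.+1 (lam o)) (cut_divpow c k.+1 p))
      EFinD; congr (_ + _)%E.
    rewrite -Int_cut_divpow_lt //; apply: eq_integral => y _; congr EFin.
    by rewrite mulrAC -natrM mulnb andbC.
  - by move=> y cy h; rewrite h //; lia.
  - by move=> y h; rewrite h //; lia.
have l0 := nleaves_gt0 l; have r0 := nleaves_gt0 r.
have [|tll hdl vtl vhl] := hl o; first by move=> q hq; apply: hb => /=; lia.
have [|tlr hdr vtr vhr] := hr (o + nleaves l)%N; first by move=> q hq; apply: hb => /=;
  lia.
set o' := (o + nleaves l)%N in tlr hdr vtr vhr *.
set p0 := lam o'.
have /andP[cp0 p0C] : c <= p0 <= C by apply: hb => /=; rewrite /o'; lia.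
have p0l q : (o <= q < o + nleaves l)%N -> p0 <= lam q by move=> hq; apply: lam_anti;
  rewrite /o'; lia.
have p0r q : (o' <= q < o' + nleaves r)%N -> lam q <= p0 by move=> hq; apply: lam_anti;
  lia.
have El0 : 0 <= E l o 0 by rewrite -(vtl p0 cp0 p0l); case: (nonneg_meas_upper l o).
have Er0 : 0 <= E r o' 0 by rewrite -(vhr p0 p0r); case: (nonneg_meas_lower r o').
have nd := nonneg_meas_density l r o.
have M k : Int (fun x => cut_divpow c k x * root_density l r o x) =
  (E (Node l r) o k)%:E.
  have n1 : nonneg_meas (fun x : R => (p0 <= x)%R%:R * cut_divpow c k x *
    upper_mass l o x) by exact: nonneg_measM (nonneg_measM (nonneg_meas_ge p0)
    (nonneg_meas_cut_divpow c k)) (nonneg_meas_upper l o).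
  have n2 : nonneg_meas (fun x : R => (x < p0)%R%:R * cut_divpow c k x *
    lower_mass r o' x) by exact: nonneg_measM (nonneg_measM (nonneg_meas_lt p0)
    (nonneg_meas_cut_divpow c k)) (nonneg_meas_lower r o').
  (* the splitting of the density at p0 *)
  transitivity (Int (fun x => E r o' 0 * ((p0 <= x)%R%:R * cut_divpow c k x *
    upper_mass l o x) +
                          E l o 0 * ((x < p0)%R%:R * cut_divpow c k x *
                            lower_mass r o' x))).
    apply: eq_integral => x _; congr EFin; rewrite /root_density -/o'.
    case: (leP p0 x) => xp.
      rewrite (vhr x) => [|q /p0r /le_trans]; last exact.
      rewrite (le_trans cp0 xp) /= !mul0r mulr0 addr0 mul1r; case: (leP x C) => [_|xC].
        by rewrite mul1r; ring.
      rewrite upper_mass0 ?mul0r ?mulr0 // => q hq; apply: le_lt_trans xC.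
      by have/andP[_ //] : c <= lam q <= C by apply: hb => /=; lia.
    rewrite !mul0r mulr0 add0r mul1r; case: (leP c x) => cx; last first.
      by rewrite /cut_divpow leNgt cx !mul0r mulr0.
    rewrite (le_trans (ltW xp) p0C) mul1r (vtl x) // => [|q /p0l]; first by ring.
    exact: le_trans (ltW xp).
  rewrite (IntD (nonneg_measM (nonneg_meas_cst _ Er0) n1) (nonneg_measM
    (nonneg_meas_cst _ El0) n2)) (IntZ Er0 n1) (IntZ El0 n2).
  have := tll k p0 cp0 p0l; have := hdr k p0 cp0 p0r.
  move: (Int (fun x => (p0 <= x)%R%:R * cut_divpow c k x * upper_mass l o x)) => A.
  move: (Int (fun x => (x < p0)%R%:R * cut_divpow c k x * lower_mass r o' x)) => B.
  move: A B => [A| |] [B| |] //; rewrite -!EFinD => -[hB] [hA].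
  congr EFin; rewrite /= -/o'.
  have -> : A = E l o k.+1 - cut_divpow c k.+1 p0 * E l o 0 by rewrite -hA addrK.
  have -> : B = cut_divpow c k.+1 p0 * E r o' 0 - E r o' k.+1 by rewrite -hB addrK.
  by ring.
have dens_ge p : (forall q, (o <= q < o + nleaves (Node l r))%N -> p <= lam q) ->
    forall x, (p <= x)%R%:R * root_density l r o x = root_density l r o x.
  move=> h x; case: (leP p x) => xp; first by rewrite mul1r.
  rewrite /root_density [X in upper_mass _ _ _ * X]lower_mass0 ?mulr0 // => q hq.
  by apply: lt_le_trans xp _; apply: h => /=; rewrite -/o' in hq; lia.
have dens_le p : (forall q, (o <= q < o + nleaves (Node l r))%N -> lam q <= p) ->
    forall x, (x <= p)%R%:R * root_density l r o x = root_density l r o x.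
  move=> h x; case: (leP x p) => xp; first by rewrite mul1r.
  rewrite /root_density upper_mass0 ?mul0r ?mulr0 // => q hq.
  by apply: le_lt_trans xp; apply: h => /=; lia.
have M0 : Int (root_density l r o) = (E (Node l r) o 0)%:E.
  rewrite -M; apply: eq_integral => x _; congr EFin.
  by case: (ltP x c) => cx; [rewrite root_density_lt ?mulr0|rewrite cut_divpow0 ?mul1r].
split.
- move=> k p cp h.
  have := @moment_tail _ c k p _ _ cp nd (nonneg_meas_upper (Node l r) o)
    (upper_mass_node l r o).
  rewrite (_ : Int (fun x => (p <= x)%R%:R * (cut_divpow c k.+1 x *
    root_density l r o x)) = (E (Node l r) o k.+1)%:E); last first.
    by rewrite -M; apply: eq_integral => x _; congr EFin; rewrite mulrCA dens_ge.
  rewrite (_ : Int (fun x => (p <= x)%R%:R * root_density l r o x) =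
    (E (Node l r) o 0)%:E) //.
  by rewrite -M0; apply: eq_integral => x _; congr EFin; rewrite dens_ge.
- move=> k p cp h.
  have := @moment_head _ c k p _ _ cp nd (nonneg_meas_lower (Node l r) o)
    (@root_density_lt l r o) (lower_mass_node l r o).
  rewrite (Int_lt_le _ nd) (Int_lt_le _ (nonneg_measM (nonneg_meas_cut_divpow c k.+1)
    nd)).
  rewrite (_ : Int (fun x => (x <= p)%R%:R * (cut_divpow c k.+1 x *
    root_density l r o x)) = (E (Node l r) o k.+1)%:E); last first.
    by rewrite -M; apply: eq_integral => x _; congr EFin; rewrite mulrCA dens_le.
  rewrite (_ : Int (fun x => (x <= p)%R%:R * root_density l r o x) =
    (E (Node l r) o 0)%:E) //.
  by rewrite -M0; apply: eq_integral => x _; congr EFin; rewrite dens_le.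
- move=> y cy h; apply: EFin_inj; rewrite upper_mass_node -M0.
  by apply: eq_integral => x _; congr EFin; rewrite dens_ge.
- move=> y h; apply: EFin_inj; rewrite lower_mass_node -M0.
  by apply: eq_integral => x _; congr EFin; rewrite dens_le.
Qed.
End TreeDensity.

(** * Iterated Lebesgue measure, tree by tree *)

Section Blocks.
Local Open Scope classical_set_scope.
Local Open Scope ring_scope.
Variable R : realType.
Notation mu := (@lebesgue_measure R).
Notation Int f := (\int[mu]_x (f x)%:E)%E.
Implicit Type S : seq R -> bool.

(** Stated on lists, so that a list of coordinates can be cut into the blocks of
    the subtrees without casts between types of tuples. *)
Definition seq_volume d S : \bar R := @lebesgue_tuple R d [set x | S (val x)].

Lemma seq_volume0 S : seq_volume 0 S = ((S [::])%:R)%:E.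
Proof. by rewrite /seq_volume /= diracE; congr (nat_of_bool _)%:R%:E; apply/idP/idP;
  rewrite inE. Qed.

Lemma seq_volumeS d S :
  seq_volume d.+1 S = (\int[mu]_y seq_volume d (fun ys => S (y :: ys)))%E.
Proof.
rewrite /seq_volume /= /pushforward /product_measure1; apply: eq_integral => y _ /=.
congr lebesgue_tuple; apply/seteqP; split=> ys /=; rewrite /xsection /= ?inE //=.
Qed.

Lemma eq_seq_volume d S S' :
  (forall ys, size ys = d -> S ys = S' ys) -> seq_volume d S = seq_volume d S'.
Proof.
move=> h; congr lebesgue_tuple; apply/seteqP; split=> ys /=; by rewrite h ?size_tuple.
Qed.

Lemma seq_volume_ge0 d S : (0 <= seq_volume d S)%E.
Proof.
elim: d S => [|d IH] S; first by rewrite seq_volume0 lee_fin.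
by rewrite seq_volumeS; apply: integral_ge0 => y _; apply: IH.
Qed.

Lemma seq_volume_false d : seq_volume d xpred0 = 0%E.
Proof.
elim: d => [|d IH]; first by rewrite seq_volume0.
by rewrite seq_volumeS; apply: integral0_eq => y _; apply: IH.
Qed.

Variables (lam : nat -> R) (c C : R).
Hypothesis cC : c <= C.

Fixpoint ninternal (t : btree) : nat := if t is Node l r then (ninternal l +
  ninternal r).+1 else 0%N.

Definition rootval (t : btree) o (ys : seq R) : R :=
  if t is Leaf then lam o else head 0 ys.

(** The inequalities of the polytope of a tree, its internal nodes being listed
    in preorder: the root, then the left subtree, then the right subtree. *)
Fixpoint tree_sat (t : btree) o (ys : seq R) : bool :=
  if t is Node l r then
    let ys1 := take (ninternal l) (behead ys) in
    let ys2 := drop (ninternal l) (behead ys) in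
    [&& head 0 ys <= rootval l o ys1, rootval r (o + nleaves l) ys2 <= head 0 ys,
        tree_sat l o ys1 & tree_sat r (o + nleaves l) ys2]
  else true.

(** The volume of the part of the polytope of t where the root lies in B. *)
Definition root_mass t o (B : R -> bool) : \bar R :=
  if t is Node l r then Int (fun x => (B x)%:R *
    root_density lam c C l r o x) else ((B (lam o))%:R)%:E.

Lemma root_mass_upper t o y :
  root_mass t o (fun x => y <= x) = (upper_mass lam c C t o y)%:E.
Proof. by case: t => //= l r; rewrite upper_mass_node. Qed.

Lemma root_mass_lower t o y :
  root_mass t o (fun x => x <= y) = (lower_mass lam c C t o y)%:E.
Proof. by case: t => //= l r; rewrite lower_mass_node. Qed.

(** The root is the outermost variable of integration; once its value y is
    fixed, the constraints on the left block, the right block and the remaining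
    coordinates are independent.  The arbitrary condition S on the rest is what
    lets the induction treat the blocks one after the other. *)
Lemma seq_volume_tree t o rest (B : R -> bool) S :
  (forall q, (o <= q < o + nleaves t)%N -> c <= lam q <= C) ->
  nonneg_meas (fun x : R => (B x)%:R : R) ->
  seq_volume (ninternal t + rest) (fun ys => [&& tree_sat t o (take (ninternal t) ys),
     B (rootval t o (take (ninternal t) ys)) & S (drop (ninternal t) ys)]) =
  (root_mass t o B * seq_volume rest S)%E.
Proof.
elim: t o rest B S => [|l hl r hr] o rest B S hb nB.
  rewrite /= add0n; case: (B (lam o)); last by rewrite mul0e -(seq_volume_false rest);
    apply: eq_seq_volume.
  by rewrite mul1e; apply: eq_seq_volume => ys _; rewrite drop0.
set o' := (o + nleaves l)%N.
have hbl q : (o <= q < o + nleaves l)%N -> c <= lam q <= C by move=> hq;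
  apply: hb => /=; lia.
have hbr q : (o' <= q < o' + nleaves r)%N -> c <= lam q <= C.
  by rewrite /o' => hq; apply: hb => /=; lia.
rewrite [ninternal (Node l r)]/= addSn seq_volumeS.
transitivity (\int[mu]_y (((B y)%:R * root_density lam c C l r o y)%:E *
  seq_volume rest S))%E; last first.
  rewrite ge0_integralZr ?seq_volume_ge0 //.
  - by apply: nonneg_measE; apply: nonneg_measM nB (nonneg_meas_density lam cC l r o).
  - by move=> x _; rewrite lee_fin; apply: mulr_ge0;
    [exact: ler0n|case: (nonneg_meas_density lam cC l r o)].
apply: eq_integral => y _.
(* S' gathers the conditions on the right block and on the remaining coordinates. *)
pose S' zs := [&& tree_sat r o' (take (ninternal r) zs),
  rootval r o' (take (ninternal r) zs) <= y & S (drop (ninternal r) zs)].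
transitivity (seq_volume (ninternal l + (ninternal r + rest)) (fun ys =>
  [&& tree_sat l o (take (ninternal l) ys),
     y <= rootval l o (take (ninternal l) ys) & B y && S' (drop (ninternal l) ys)])).
  rewrite addnA; apply: eq_seq_volume => ys _ /=.
  have -> : take (ninternal l) (take (ninternal l + ninternal r) ys) =
    take (ninternal l) ys.
    by rewrite take_takel // leq_addr.
  have -> : drop (ninternal l) (take (ninternal l + ninternal r) ys) =
    take (ninternal r) (drop (ninternal l) ys).
    by rewrite take_drop addnC.
  rewrite /S' drop_drop [in RHS]addnC -/o'.
  case: (y <= _); case: (_ <= y); case: (tree_sat l _ _); case: (tree_sat r _ _);
    case: (B y) => //=.
apply: etrans (hl o _ (fun x => y <= x) (fun zs =>
  B y && S' zs) hbl (nonneg_meas_ge y)) _.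
rewrite root_mass_upper; case: (B y) => /=;
  last by rewrite seq_volume_false mule0 mul0r mul0e.
have hr' := hr o' rest (fun x => x <= y) S hbr (nonneg_meas_le y).
transitivity ((upper_mass lam c C l o y)%:E * (root_mass r o' (fun x => (x <= y)%R) *
  seq_volume rest S))%E.
  by congr (_ * _)%E; exact: hr'.
rewrite root_mass_lower muleA -EFinM mul1r; congr (_%:E * _)%E.
rewrite /root_density -/o'; case: (leP c y) => cy /=; last first.
  rewrite lower_mass0 ?mulr0 // => q hq; apply: lt_le_trans cy _.
  by have /andP[] := hbr q hq.
case: (leP y C) => yC; first by rewrite mul1r.
rewrite upper_mass0 ?mul0r ?mulr0 // => q hq; apply: le_lt_trans yC.
by have /andP[] := hbl q hq.
Qed.

Hypothesis lam_dec : forall i, lam i.+1 <= lam i.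
Notation E := (moment (fun p k => cut_divpow c k (lam p))).

Lemma root_massT t o : (forall q, (o <= q < o + nleaves t)%N -> c <= lam q <= C) ->
  root_mass t o xpredT = (E t o 0)%:E.
Proof.
move=> hb; have [_ _ hV _] := tree_moments cC lam_dec hb.
rewrite -(hV c) // => [|q /hb /andP[] //]; rewrite -root_mass_upper.
case: t {hV} hb => [|l r] hb /=.
  by have /andP[-> _] : c <= lam o <= C by apply: hb => /=; lia.
apply: eq_integral => x _; congr EFin; rewrite mul1r.
by case: (leP c x) => cx; rewrite ?mul1r // root_density_lt ?mulr0.
Qed.

Fixpoint trees_sat (ts : seq (btree * nat)) (ys : seq R) : bool :=
  if ts is (t, o) :: ts' then tree_sat t o (take (ninternal t) ys) && trees_sat ts'
    (drop (ninternal t) ys)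
  else true.

Lemma seq_volume_trees (ts : seq (btree * nat)) :
  (forall t o q, (t, o) \in ts -> (o <= q < o + nleaves t)%N -> c <= lam q <= C) ->
  seq_volume (sumn [seq ninternal u.1 | u <- ts]) (trees_sat ts) =
    (\prod_(u <- ts) E u.1 u.2 0)%:E.
Proof.
elim: ts => [|[t o] ts IH] hb; first by rewrite seq_volume0 big_nil.
have hbt q : (o <= q < o + nleaves t)%N -> c <= lam q <= C.
  by apply: hb; rewrite inE eqxx.
rewrite /= big_cons EFinM -IH => [|t' o' q h]; last by apply: hb; rewrite inE h orbT.
by rewrite -(root_massT hbt) -seq_volume_tree //; exact: (nonneg_meas_cst _ ler01).
Qed.
End Blocks.

(** * The volume of a forest polytope *)

Lemma size_tree_internal t : size (tree_internal t) = ninternal t.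
Proof. by elim: t => //= l hl r hr; rewrite size_cat !size_map hl hr. Qed.

Lemma consb_inj (b : bool) : injective (cons b). Proof. by move=> x y []. Qed.

Lemma mem_cons_lr (b : bool) q (A B : seq (seq bool)) :
  ((b :: q) \in map (cons false) A ++ map (cons true) B) = (q \in if b then B else A).
Proof.
rewrite mem_cat; case: b.
  rewrite (mem_map (@consb_inj true)) [X in X || _](_ : _ = false) //.
  by apply/negbTE/mapP => [[]].
rewrite (mem_map (@consb_inj false)) [X in _ || X](_ : _ = false) ?orbF //.
by apply/negbTE/mapP => [[]].
Qed.

Lemma nil_notin_lr (A B : seq (seq bool)) :
  [::] \notin map (cons false) A ++ map (cons true) B.
Proof. by rewrite mem_cat negb_or; apply/andP; split; apply/mapP => [[]]. Qed.

Lemma uniq_lr (A B : seq (seq bool)) :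
  uniq A -> uniq B -> uniq (map (cons false) A ++ map (cons true) B).
Proof.
move=> uA uB; rewrite cat_uniq !map_inj_uniq ?uA ?uB //; try exact: consb_inj.
by rewrite andbT; apply/hasPn => q /mapP[q' _ ->]; apply/mapP => [[]].
Qed.

Lemma uniq_tree_internal t : uniq (tree_internal t).
Proof. by elim: t => //= l hl r hr; rewrite nil_notin_lr uniq_lr. Qed.

Lemma child_mem t p b : p \in tree_internal t ->
  (rcons p b \in tree_internal t) || (rcons p b \in tree_leaves t).
Proof.
elim: t p => //= l hl r hr [|b' p] /=.
  by case: b {hl hr}; rewrite !inE !mem_cons_lr /=; [case: r|case: l].
rewrite !inE /= !mem_cons_lr; case: b'; [exact: hr|exact: hl].
Qed.

Section Forest.
Local Open Scope classical_set_scope.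
Local Open Scope ring_scope.
Variable R : realType.
Variables (lam : nat -> R).

(** The values at the nodes of one tree, by address: f inside, lam at leaves. *)
Definition tree_extend t o (f : seq bool -> R) (q : seq bool) : R :=
  if q \in tree_internal t then f q else lam (o + index q (tree_leaves t)).

Lemma rootval_extend t o f :
  rootval lam t o (map f (tree_internal t)) = tree_extend t o f [::].
Proof. by case: t => [|l r] /=; rewrite /tree_extend /= ?addn0. Qed.

Lemma tree_extend_node l r o f b q :
  (q \in tree_internal (if b then r else l)) || (q \in tree_leaves (if b then r else
    l)) ->
  tree_extend (Node l r) o f (b :: q) =
  tree_extend (if b then r else l) (if b then o + nleaves l else o)%N (fun p =>
    f (b :: p)) q.
Proof.
rewrite /tree_extend /= inE /= mem_cons_lr index_cat; case: b => /= hq.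
  case: (boolP (q \in tree_internal r)) hq => //= hn hq; congr lam.
  rewrite ifF; last by apply/negbTE/mapP => [[]].
  by rewrite size_map size_tree_leaves (index_map (@consb_inj true)) addnA.
case: (boolP (q \in tree_internal l)) hq => //= hn hq; congr lam.
by rewrite (mem_map (@consb_inj false)) hq (index_map (@consb_inj false)).
Qed.

Lemma tree_satP t o f : reflect
  (forall p, p \in tree_internal t ->
     f p <= tree_extend t o f (rcons p false) /\ tree_extend t o f (rcons p true) <= f
       p)
  (tree_sat lam t o (map f (tree_internal t))).
Proof.
elim: t o f => [|l hl r hr] o f /=; first by apply: ReflectT.
rewrite map_cat -!map_comp take_size_cat ?drop_size_cat ?size_map ?size_tree_internal
  //.
rewrite !rootval_extend.
have ext0 b : tree_extend (Node l r) o f [:: b] =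
  tree_extend (if b then r else l) (if b then o + nleaves l else o)%N (fun p =>
    f (b :: p)) [::].
  by apply: tree_extend_node; case: b; [case: r {hr}|case: l {hl}].
have extc b p b' : p \in tree_internal (if b then r else l) ->
  tree_extend (Node l r) o f (b :: rcons p b') =
  tree_extend (if b then r else l) (if b then o + nleaves l else o)%N (fun p =>
    f (b :: p)) (rcons p b').
  by move=> hp; apply: tree_extend_node; apply: child_mem.
apply: (iffP and4P) => [[h1 h2 /hl h3 /hr h4] p|h].
  rewrite inE => /orP[/eqP ->|]; first by rewrite /= !ext0.
  case: p => [|b p]; first by rewrite (negbTE (nil_notin_lr _ _)).
  rewrite mem_cons_lr /=; case: b => hp.
    by rewrite (extc true) // (extc true) //; apply: h4.
  by rewrite (extc false) // (extc false) //; apply: h3.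
have [h1 h2] := h [::] (mem_head _ _); rewrite /= !ext0 in h1 h2; split=> //.
  apply/hl => p hp; have [|] := h (false :: p);
    first by rewrite inE mem_cons_lr hp orbT.
  by rewrite /= (extc false) // (extc false).
apply/hr => p hp; have [|] := h (true :: p); first by rewrite inE mem_cons_lr hp orbT.
by rewrite /= (extc true) // (extc true).
Qed.

Variable F : forest.

Definition offset i : nat := (\sum_(j < i) size (tree_leaves (F j)))%N.

Lemma trees_satP (s : seq nat) (g : node -> R) : reflect
  (forall i, i \in s -> tree_sat lam (F i) (offset i) [seq g (i,
    p) | p <- tree_internal (F i)])
  (trees_sat lam [seq (F i, offset i) | i <- s]
     [seq g v | v <- [seq (i, p) | i <- s, p <- tree_internal (F i)]]).
Proof.
elim: s => [|i s IH] /=; first by apply: ReflectT.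
rewrite map_cat -map_comp take_size_cat ?drop_size_cat ?size_map ?size_tree_internal //.
apply: (iffP andP) => [[h1 /IH h2] j|h].
  by rewrite inE => /orP[/eqP -> //|/h2].
split; first by apply: h; rewrite mem_head.
by apply/IH => j hj; apply: h; rewrite inE hj orbT.
Qed.

Lemma uniq_internal : uniq (internal F).
Proof.
apply: allpairs_uniq_dep; first exact: fset_uniq.
  by move=> i _; exact: uniq_tree_internal.
by move=> [i p] [j q] _ _ /= [-> ->].
Qed.

Lemma val_enum_IN : map val (enum (IN F)) = internal F.
Proof. by rewrite enumT unlock; apply: val_seq_sub_enum; exact: uniq_internal. Qed.

Lemma card_IN : #|IN F| = size (internal F).
Proof. by rewrite -val_enum_IN size_map cardE. Qed.

Lemma enum_rank_IN (v : IN F) : enum_rank v = index (val v) (internal F) :> nat.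
Proof.
have -> : index (val v) (internal F) = index (val v) (map val (enum (IN F))).
  by rewrite val_enum_IN.
rewrite index_map; last exact: val_inj.
by rewrite -{2}(nth_enum_rank v v) index_uniq ?enum_uniq // -cardE.
Qed.

Lemma size_internal : size (internal F) =
  sumn [seq ninternal u.1 | u <- [seq (F i, offset i) | i <- finsupp F]].
Proof.
rewrite /internal size_allpairs_dep -map_comp; congr sumn; apply: eq_map => i.
by rewrite /= size_tree_internal.
Qed.

Lemma mem_internal i p : ((i, p) \in internal F) = (p \in tree_internal (F i)).
Proof.
apply/allpairsPdep/idP => [[j [q [hj hq [-> ->]]]] //|hp].
exists i, p; split=> //; rewrite mem_finsupp; apply: contraL hp => /eqP ->.
by rewrite in_nil.
Qed.

Lemma polytope_satF (x : #|IN F|.-tuple R) :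
  forest_polytope lam (fun v : IN F => tnth x (enum_rank v)) <->
  trees_sat lam [seq (F i, offset i) | i <- finsupp F] x.
Proof.
pose g (v : node) := nth 0 x (index v (internal F)).
have xE : val x = [seq g v | v <- internal F].
  apply: (@eq_from_nth _ 0); first by rewrite size_tuple size_map card_IN.
  move=> i hi; have {}hi : (i < size (internal F))%N by rewrite -card_IN -(size_tuple
    x).
  by rewrite (nth_map (0%N, [::])) // /g index_uniq // uniq_internal.
have gE (v : IN F) : tnth x (enum_rank v) = g (val v).
  by rewrite (tnth_nth 0) enum_rank_IN.
have extE i p : extend lam (fun v : IN F => tnth x (enum_rank v)) (i, p) =
   tree_extend (F i) (offset i) (fun p => g (i, p)) p.
  rewrite /extend /tree_extend -mem_internal; case: insubP => [u -> hu|/negbTE -> //].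
  by rewrite gE hu.
rewrite xE; split.
  move=> h; apply/trees_satP => i hi; apply/tree_satP => p hp.
  have hv : (i, p) \in internal F by rewrite mem_internal.
  have := h (SeqSub hv); rewrite gE /lchild /rchild /= !extE.
  by case.
move/trees_satP => h v; have hv := valP v; rewrite gE.
case: (val v) hv => i p hv; rewrite /lchild /rchild /= !extE.
have hp : p \in tree_internal (F i) by rewrite -mem_internal.
have hi : i \in finsupp F.
  by rewrite mem_finsupp; apply: contraL hp => /eqP ->; rewrite in_nil.
by have /tree_satP/(_ p hp) := h i hi.
Qed.

Hypothesis lam_dec : forall i, lam i.+1 <= lam i.

Lemma Vol_forest c C : c <= C ->
  (forall i q, i \in finsupp F -> (offset i <= q < offset i + nleaves (F i))%N ->
    c <= lam q <= C) ->
  Vol (@forest_polytope R F lam) =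
  (\prod_(i <- finsupp F) moment (fun p k =>
    cut_divpow c k (lam p)) (F i) (offset i) 0)%:E.
Proof.
move=> cC hb; transitivity (seq_volume #|IN F| (trees_sat lam [seq (F i,
  offset i) | i <- finsupp F])).
  rewrite /Vol /seq_volume; congr lebesgue_tuple; apply/seteqP; split=> x /=;
    by rewrite polytope_satF.
rewrite card_IN size_internal (@seq_volume_trees _ lam c C cC lam_dec) ?big_map //.
by move=> t o q /mapP[i hi [-> ->]]; apply: hb.
Qed.
End Forest.

(** * Forests as lists of trees, and the least monomials of their volumes *)

Section LexminVolume.
Variable n : nat.

Definition mnm_of_seq o (s : seq nat) : 'X_{1..n} :=
  [multinom (if (o <= i)%N then nth 0%N s (i - o) else 0%N) | i < n].

Lemma mnm_of_seqE o s (i : 'I_n) :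
  mnm_of_seq o s i = if (o <= i)%N then nth 0%N s (i - o) else 0%N.
Proof. exact: mnmE. Qed.

Lemma mnm_of_seq_cat o s t :
  mnm_of_seq o (s ++ t) = (mnm_of_seq o s + mnm_of_seq (o + size s) t)%MM.
Proof.
apply/mnmP => i; rewrite mnmDE !mnm_of_seqE nth_cat.
case: (leqP o i) => h; last by rewrite ifF //; lia.
case: ltnP => h2; first by rewrite ifF ?addn0 //; lia.
by rewrite (nth_default 0%N h2) add0n ifT ?subnDA //; lia.
Qed.

Lemma mnm_of_seq_inj s t :
  size s = n -> size t = n -> mnm_of_seq 0 s = mnm_of_seq 0 t -> s = t.
Proof.
move=> hs ht /mnmP h; apply: (@eq_from_nth _ 0%N); rewrite hs ?ht // => i hi.
by have := h (Ordinal hi); rewrite !mnm_of_seqE /= subn0.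
Qed.

(** At the last leaf of l, the first word has a smaller letter. *)
Lemma mnm_of_leaf_code_lt o l r k : (o + nleaves l + nleaves r <= n)%N ->
  lexlt (mnm_of_seq o (leaf_code l 0 ++ leaf_code r k.+1)) (mnm_of_seq o (leaf_code l
    k.+1 ++ leaf_code r 0)).
Proof.
move=> hn; have [u [a hu]] := leaf_code_rcons l.
have hsz : size u = (nleaves l).-1 by rewrite -(size_leaf_code l 0) hu size_rcons.
have l0 := nleaves_gt0 l; have r0 := nleaves_gt0 r.
have hlt : (o + size u < n)%N by lia.
apply/lexltP; exists (Ordinal hlt); rewrite /= ?mnm_of_seqE /= !hu.
  rewrite leq_addr addKn !nth_cat !size_rcons ltnSn !nth_rcons ltnn eqxx; lia.
move=> i hi; rewrite !mnm_of_seqE; case: leqP => // oi.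
have h1 : (i - o < size u)%N by move: hi => /=; lia.
by rewrite !nth_cat !size_rcons !nth_rcons ltnS (ltnW h1) h1.
Qed.

Lemma lexmin_moment t o k : (o + nleaves t <= n)%N ->
  lexmin (moment (divpow n) t o k) (mnm_of_seq o (leaf_code t k)).
Proof.
elim: t o k => [|l hl r hr] o k /= hn.
  have hon : (o < n)%N by lia.
  have -> : mnm_of_seq o [:: k] = (U_(Ordinal hon) *+ k)%MM.
    apply/mnmP => i; rewrite mnm_of_seqE mulmnE mnm1E -val_eqE /=.
    case: (ltngtP o i) => h /=; rewrite ?mul0n //; last by rewrite h subnn mul1n.
    by rewrite nth_default //=; lia.
  rewrite (divpow_ord (Ordinal hon)); have hk : (k`!%:R^-1 : rat) != 0.
    by rewrite invr_eq0 pnatr_eq0 -lt0n fact_gt0.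
  apply: lexminP; first by rewrite mcoeffZ mcoeffX eqxx mulr1.
  by move=> m'; rewrite mcoeffZ mcoeffX; case: (_ =P m') => [->|_];
    rewrite ?mulr0 ?eqxx.
have hrl : (o + nleaves l + nleaves r <= n)%N by lia.
apply: (@lexminB _ _ _ _ (mnm_of_seq o (leaf_code l k.+1 ++ leaf_code r 0))).
- rewrite mnm_of_seq_cat size_leaf_code; apply: lexminM; [apply: hl; lia|exact: hr].
- rewrite mnm_of_seq_cat size_leaf_code; apply: lexminM; [apply: hl; lia|exact: hr].
exact: mnm_of_leaf_code_lt.
Qed.

Lemma lexmin1 : lexmin (1 : {mpoly rat[n]}) 0%MM.
Proof.
apply: lexminP; first by rewrite mcoeff1 eqxx oner_eq0.
by move=> m'; rewrite mcoeff1; case: (m' =P _) => [->|_] //; rewrite mulr0n eqxx.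
Qed.

Lemma lexmin_volume_prod ts o : (o + sumn (map nleaves ts) <= n)%N ->
  lexmin (volume_prod (divpow n) ts o) (mnm_of_seq o (leaf_codes ts)).
Proof.
elim: ts o => [|t ts IH] o /= hn.
  have -> : mnm_of_seq o [::] = 0%MM.
    by apply/mnmP => i; rewrite mnm_of_seqE mnm0E nth_nil; case: leqP.
  exact: lexmin1.
rewrite mnm_of_seq_cat size_leaf_code; apply: lexminM; first by apply: lexmin_moment;
  lia.
by apply: IH; lia.
Qed.
End LexminVolume.

Section ForestLists.

Lemma offsetS (F : forest) i : offset F i.+1 = (offset F i + nleaves (F i))%N.
Proof. by rewrite /offset big_ord_recr /= size_tree_leaves. Qed.

Lemma uniq_tree_leaves t : uniq (tree_leaves t).
Proof. by elim: t => //= l hl r hr; rewrite uniq_lr. Qed.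

Lemma mem_supp (F : forest) i q : F i <> Leaf ->
  (offset F i <= q < offset F i.+1)%N -> q \in supp F.
Proof.
move=> hi hq; apply/allpairsPdep.
have hs : (q - offset F i < size (tree_leaves (F i)))%N.
  by move: hq; rewrite offsetS size_tree_leaves; lia.
exists i, (nth [::] (tree_leaves (F i)) (q - offset F i)); split.
- by rewrite mem_finsupp; apply/eqP.
- exact: mem_nth.
rewrite /leaf_label /= index_uniq ?uniq_tree_leaves //.
by rewrite -/(offset F i); lia.
Qed.

Lemma suppP (F : forest) q : q \in supp F ->
  exists2 i, F i <> Leaf & (offset F i <= q < offset F i.+1)%N.
Proof.
case/allpairsPdep => [i [p [hi hp ->]]]; exists i.
  by apply/eqP; rewrite -mem_finsupp.
rewrite /leaf_label /= -/(offset F i) leq_addr offsetS ltn_add2l.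
by rewrite -size_tree_leaves index_mem.
Qed.

Lemma offset_le (F : forest) i j : (i <= j)%N -> (offset F i + (j - i) <= offset F j)%N.
Proof.
move=> /subnK <-; elim: (j - i)%N => [|k IH]; first by rewrite add0n subnn addn0.
by rewrite addSn offsetS; have := nleaves_gt0 (F (k + i)%N); lia.
Qed.

Lemma offset_list (F : forest) i :
  offset F i = sumn (map nleaves [seq F j | j <- iota 0 i]).
Proof.
elim: i => [|i IH]; first by rewrite /offset big_ord0.
by rewrite offsetS IH -addn1 iotaD map_cat map_cat sumn_cat /= addn0.
Qed.

Definition represents (F : forest) ts := forall i, F i = nth Leaf ts i.

Lemma offset_nth (F : forest) ts i : represents F ts ->
  (i <= size ts)%N -> offset F i = sumn (map nleaves (take i ts)).
Proof.
move=> h hi; rewrite offset_list; congr (sumn (map _ _)).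
apply: (@eq_from_nth _ Leaf); first by rewrite size_map size_iota size_take;
  case: ltnP hi; lia.
move=> j; rewrite size_map size_iota => hj.
by rewrite (nth_map 0%N) ?size_iota // nth_iota // add0n nth_take.
Qed.

(** Cut after the trees that cover the first n leaves: a tree across this
    boundary, or a later nontrivial tree, would have a leaf of index >= n. *)
Lemma For_list n (F : forest) : For n F ->
  exists2 ts, represents F ts & sumn (map nleaves ts) = n.
Proof.
move=> hF.
have ex : exists i, (n <= offset F i)%N.
  by exists n; apply: leq_trans (offset_le F (leq0n n)); rewrite subn0 leq_addl.
pose i := ex_minn ex; have [hi hmin] : (n <= offset F i)%N /\ forall j,
  (n <= offset F j)%N -> (i <= j)%N.
  by rewrite /i; case: ex_minnP.
have hL j : (n < offset F j.+1)%N -> F j = Leaf.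
  move=> h; apply: contrapT => hj; have := hF (offset F j.+1).-1 (mem_supp hj _).
  have := nleaves_gt0 (F j); rewrite offsetS in h *; lia.
have ei : offset F i = n.
  case: i hi hmin => [|i] hi hmin; first by move: hi; rewrite /offset big_ord0; lia.
  apply/eqP; rewrite eqn_leq hi andbT leqNgt; apply/negP => h.
  have hlt : (offset F i < n)%N by rewrite ltnNge; apply/negP => /hmin; rewrite ltnn.
  by have e := hL _ h; move: h; rewrite offsetS e /=; lia.
exists [seq F j | j <- iota 0 i]; last by rewrite -offset_list.
move=> j; case: (ltnP j i) => hj.
  by rewrite (nth_map 0%N) ?size_iota // nth_iota.
rewrite nth_default ?size_map ?size_iota //; apply: hL.
by have := offset_le F hj; rewrite offsetS ei; have := nleaves_gt0 (F j); lia.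
Qed.

Lemma list_For (F : forest) ts : represents F ts -> For (sumn (map nleaves ts)) F.
Proof.
move=> h q /suppP[i hi /andP[_ hq]].
have his : (i < size ts)%N.
  by rewrite ltnNge; apply/negP => hs; apply: hi; rewrite h nth_default.
apply: leq_trans hq _;
  rewrite (offset_nth h) // -{2}(cat_take_drop i.+1 ts) map_cat sumn_cat.
exact: leq_addr.
Qed.

Lemma represents_exists ts : exists F : forest, represents F ts.
Proof.
exists [fsfun i in seq_fset tt (iota 0 (size ts)) => nth Leaf ts i | Leaf] => i.
rewrite fsfunE seq_fsetE mem_iota /= add0n; case: ltnP => // h.
by rewrite nth_default.
Qed.

Lemma represents_inj F F' ts : represents F ts -> represents F' ts -> F = F'.
Proof. by move=> h h'; apply/fsfunP => i; rewrite h h'. Qed.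

Lemma prod_moments (A : comNzRingType) (x : nat -> nat -> A) (F : forest) ts :
  (forall o, (o < sumn (map nleaves ts))%N -> x o 0%N = 1) -> represents F ts ->
  \prod_(i <- finsupp F) moment x (F i) (offset F i) 0 = volume_prod x ts 0.
Proof.
move=> x0 h.
have hoff i : (i < size ts)%N -> (offset F i < sumn (map nleaves ts))%N.
  move=> hi; have : (offset F i.+1 <= sumn (map nleaves ts))%N.
    by rewrite (offset_nth h) // -{2}(cat_take_drop i.+1 ts) map_cat sumn_cat leq_addr.
  by rewrite offsetS; have := nleaves_gt0 (F i); lia.
transitivity (\prod_(i <- iota 0 (size ts)) moment x (F i) (offset F i) 0).
  rewrite [RHS](bigID (fun i => i \in finsupp F)) /= [X in _ = _ * X]big1_seq ?mulr1;
    last first.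
    move=> i /andP[]; rewrite mem_finsupp negbK mem_iota => /eqP -> hi /=; apply: x0.
    by apply: hoff; lia.
  rewrite -[RHS]big_filter; apply: perm_big; apply: uniq_perm;
    rewrite ?filter_uniq ?iota_uniq //.
    exact: fset_uniq.
  move=> i; rewrite mem_filter mem_iota /= add0n;
    case: (boolP (i \in finsupp F)) => //= hi.
  apply/esym; rewrite ltnNge; apply/negP => hs; move: hi.
  by rewrite mem_finsupp h nth_default // eqxx.
have gen k us : (k + size us = size ts)%N -> drop k ts = us ->
   \prod_(i <- iota k (size us)) moment x (F i) (offset F i) 0 =
     volume_prod x us (offset F k).
  elim: us k => [|u us IH] k hk hd; first by rewrite big_nil.
  have hF : F k = u.
    by rewrite h -[k in nth _ _ k]addn0 -nth_drop hd.
  rewrite /= big_cons IH; last 2 first.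
  - by move: hk => /=; lia.
  - by rewrite -add1n -drop_drop hd /= drop0.
  by rewrite offsetS hF.
by rewrite (gen 0%N) ?drop0 // /offset big_ord0.
Qed.
End ForestLists.

(** * The basis of volume polynomials *)

Section Uniqueness.
Variable R : realType.

Lemma digits_inj n D (a b : nat -> nat) :
  (forall i, (i < n)%N -> (a i < D)%N) -> (forall i, (i < n)%N -> (b i < D)%N) ->
  (\sum_(i < n) a i * D ^ i = \sum_(i < n) b i * D ^ i)%N ->
  forall i, (i < n)%N -> a i = b i.
Proof.
elim: n a b => [//|n IH] a b ha hb.
have step (f : nat -> nat) : (\sum_(i < n.+1) f i * D ^ i = f 0 +
  (\sum_(i < n) f i.+1 * D ^ i) * D)%N.
  rewrite big_ord_recl /= expn0 muln1; congr (_ + _)%N; rewrite big_distrl /=.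
  by apply: eq_bigr => i _; rewrite /bump /= add1n expnS -mulnA [(D * _)%N]mulnC.
rewrite !step => e.
have D0 : (0 < D)%N by have := ha 0%N isT; lia.
have e0 : a 0%N = b 0%N.
  have := congr1 (modn^~ D) e; rewrite ![(_ 0%N + _)%N]addnC !modnMDl.
  by rewrite !modn_small ?ha ?hb.
move: e; rewrite e0 => /addnI /eqP; rewrite eqn_pmul2r // => /eqP e.
case=> [//|i] hi; apply: (IH (fun i => a i.+1) (fun i => b i.+1)) => // j hj;
  [exact: ha|exact: hb].
Qed.

(** Kronecker substitution: lam_i = t^(D^i), decreasing in i for 0 < t <= 1,
    turns p into a polynomial in t, and no two monomials collide if D exceeds
    all exponents. *)
Lemma mpoly_eq0_cone n (p : {mpoly R[n]}) :
  (forall lam : nat -> R, (forall i, lam i.+1 <= lam i) -> p.@[fun i : 'I_n => lam i] =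
    0) ->
  p = 0.
Proof.
move=> h; pose D := (msize p).+1.
pose wt (m : 'X_{1..n}) := (\sum_(i < n) m i * D ^ i)%N.
pose q : {poly R} := \sum_(m <- msupp p) p@_m *: 'X^(wt m).
have wt_inj m m' : m \in msupp p -> m' \in msupp p -> wt m = wt m' -> m = m'.
  move=> hm hm' e; apply/mnmP => i.
  have hlt m1 (j : nat) : m1 \in msupp p -> (nth 0%N m1 j < D)%N.
    move=> /msize_mdeg_lt h1; case: (ltnP j n) => hj;
      last by rewrite nth_default ?size_tuple.
    rewrite -(mnm_nth 0%N m1 (Ordinal hj)); rewrite /D ltnS; apply: leq_trans (ltnW h1).
    by rewrite mdegE (bigD1 (Ordinal hj)) //= leq_addr.
  have := @digits_inj n D (nth 0%N m) (nth 0%N m').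
  rewrite !(mnm_nth 0%N); apply=> //; [by move=> j _; exact: hlt|by move=> j _;
    exact: hlt|].
  rewrite /wt in e; rewrite (eq_bigr (fun i : 'I_n => m i * D ^ i)%N) => [|j _];
    last by rewrite (mnm_nth 0%N).
  by rewrite e; apply: eq_bigr => j _; rewrite (mnm_nth 0%N).
have qE t : q.[t] = p.@[fun i : 'I_n => t ^+ (D ^ i)].
  rewrite mevalE horner_sum; apply: eq_bigr => m _; rewrite hornerZ hornerXn;
    congr (_ * _).
  rewrite /wt -prodrXr; apply: eq_bigr => i _.
  by rewrite -exprM mulnC.
have q0 : q = 0.
  apply/eqP; apply: contraT => qn0.
  pose rs := [seq (k.+1%:R)^-1 : R | k <- iota 0 (size q)].
  have := max_poly_roots qn0 (rs := rs); rewrite size_map size_iota ltnn; apply.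
    apply/allP => t /mapP[k _ ->]; apply/rootP; rewrite qE.
    set t' := _^-1; have t0 : 0 < t' by rewrite invr_gt0 ltr0n.
    have t1 : t' <= 1 by rewrite invf_le1 ?ltr0n // ler1n.
    apply: (h (fun i => t' ^+ (D ^ i))) => i.
    by rewrite ler_wiXn2l ?(ltW t0) // leq_pexp2l.
  rewrite map_inj_uniq ?iota_uniq // => j k /invr_inj /eqP.
  by rewrite eqr_nat => /eqP [].
apply/mpolyP => m0; rewrite mcoeff0; apply/eqP; rewrite mcoeff_eq0; apply/negP => hm0.
have := congr1 (fun r : {poly R} => r`_(wt m0)) q0.
rewrite /q coef_sum coef0 (bigD1_seq m0) ?msupp_uniq //= coefZ coefXn eqxx mulr1.
rewrite big1_seq ?addr0 => [/eqP|m /andP[hne hm]]; first by rewrite mcoeff_eq0 hm0.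
rewrite coefZ coefXn; case: eqP => [/(wt_inj _ _ hm0 hm) e|_]; last by rewrite mulr0.
by rewrite e eqxx in hne.
Qed.

Lemma volume_poly_unique F n (p q : {mpoly rat[n]}) :
  is_volume_poly R F p -> is_volume_poly R F q -> p = q.
Proof.
move=> hp hq; pose ev (r : {mpoly rat[n]}) := map_mpoly (ratr : rat -> R) r.
suff : ev p - ev q = 0.
  move=> /eqP; rewrite subr_eq0 => /eqP e; apply/mpolyP => m.
  have := congr1 (mcoeff m) e; rewrite !mcoeff_map_mpoly; exact: fmorph_inj.
apply: mpoly_eq0_cone => lam hlam; rewrite mevalB.
have := hq lam hlam; rewrite (hp lam hlam) => [[->]].
exact: subrr.
Qed.

(** The integrals are computed with lam shifted by a lower bound, its n-th
    value, which does not change the volume. *)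
Lemma volume_prodP (F : forest) ts : represents F ts ->
  is_volume_poly R F (volume_prod (divpow (sumn (map nleaves ts))) ts 0).
Proof.
set n := sumn _ => hF lam hlam.
have anti := lam_anti hlam.
have hoff i : i \in finsupp F -> (offset F i.+1 <= n)%N.
  move=> hi; have his : (i < size ts)%N.
    rewrite ltnNge; apply/negP => hs; move: hi.
    by rewrite mem_finsupp hF nth_default // eqxx.
  by rewrite (offset_nth hF) // /n -{2}(cat_take_drop i.+1 ts) map_cat sumn_cat
    leq_addr.
have cC : lam n <= lam 0%N by apply: anti.
rewrite (Vol_forest hlam cC); last first.
  move=> i q /hoff; rewrite offsetS => hi /andP[_ hq].
  by apply/andP; split; apply: anti => //; lia.
pose x o k : R := lam o ^+ k / k`!%:R.
congr EFin; transitivity (volume_prod x ts 0).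
  rewrite -(prod_moments _ hF) => [|o _]; last by rewrite /x expr0 divr1.
  apply: eq_big_seq => i /hoff; rewrite offsetS => hi.
  pose x' o k : R := (lam o - lam n) ^+ k / k`!%:R.
  transitivity (moment x' (F i) (offset F i) 0).
    apply: eq_moment => q j hq; rewrite /cut_divpow /x' anti ?mul1r //; lia.
  apply: (@moment_shift0 _ x x' (fun j => (- lam n) ^+ j / j`!%:R));
    first by rewrite expr0 divr1.
  move=> q k; rewrite /x' /x exprDn mulr_suml; apply: eq_bigr => j _.
  have jk : (j <= k)%N by rewrite -ltnS.
  have hf l : (l`!%:R : R) != 0 by rewrite pnatr_eq0 -lt0n fact_gt0.
  have hC : ('C(k, j)%:R : R) != 0 by rewrite pnatr_eq0 -lt0n bin_gt0.
  have -> : k`!%:R = 'C(k, j)%:R * (j`!%:R *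
    (k - j)`!%:R) :> R by rewrite -!natrM bin_fact.
  by rewrite -mulr_natr; field; rewrite !hf hC.
pose ev : {rmorphism {mpoly rat[n]} -> R} := (meval (fun i : 'I_n =>
  lam i) \o map_mpoly ratr).
have evE (p : {mpoly rat[n]}) : (map_mpoly ratr p).@[fun i : 'I_n => lam i] =
  ev p by [].
rewrite evE.
have evx o k : (o < n)%N -> ev (divpow n o k) = x o k.
  move=> ho; rewrite (divpow_ord (Ordinal ho)) /ev /= map_mpolyZ map_mpolyX mevalZ
    mevalX.
  rewrite fmorphV rmorph_nat /x mulrC; congr (_ * _).
  rewrite (bigD1 (Ordinal ho)) //= mulmnE mnm1E eqxx mul1n big1 ?mulr1 // => i hi.
  by rewrite mulmnE mnm1E eq_sym (negbTE hi) expr0.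
have gen us o : (o + sumn (map nleaves us) <= n)%N -> volume_prod x us o =
  ev (volume_prod (divpow n) us o).
  elim: us o => [|u us IH] o hn; first exact: (esym (rmorph1 ev)).
  have hn' : (o + nleaves u + sumn (map nleaves us) <= n)%N by move: hn => /=; lia.
  apply: etrans (esym (rmorphM ev _ _)).
  rewrite -IH //; congr (_ * _).
  rewrite rmorph_moment; apply: eq_moment => q j hq; rewrite evx //; lia.
by apply: gen.
Qed.

Lemma volume_polyE F ts : represents F ts ->
  volume_poly R F (sumn (map nleaves ts)) =
    volume_prod (divpow (sumn (map nleaves ts))) ts 0.
Proof.
move=> hF; have h := volume_prodP hF; apply: volume_poly_unique (h).
by rewrite /volume_poly; apply: (xgetPex 0 (ex_intro _ _ h)).
Qed.
End Uniqueness.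

Section Basis.
Variables (R : realType) (n : nat).
Notation V F := (volume_poly R F n).

Lemma volume_HQSym F : For n F -> HQSym n (V F).
Proof.
by move=> /For_list[ts hF hn]; subst n; rewrite volume_polyE //;
  apply: volume_prod_HQSym.
Qed.

Lemma volume_leaf_code F ts : represents F ts -> sumn (map nleaves ts) = n ->
  lexmin (V F) (mnm_of_seq n 0 (leaf_codes ts)).
Proof. by move=> hF hn; subst n; rewrite volume_polyE //; apply: lexmin_volume_prod.
  Qed.

Lemma volume_lexmin F : For n F -> exists m, lexmin (V F) m.
Proof. by move=> /For_list[ts hF hn]; exists (mnm_of_seq n 0 (leaf_codes ts));
  apply: volume_leaf_code. Qed.

Lemma lexmin_uniq (p : {mpoly rat[n]}) m m' : lexmin p m -> lexmin p m' -> m = m'.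
Proof.
move=> [h1 min1] [h2 min2]; apply/eqP; apply: contraT => hne.
have := lexlt_trans (min2 m h1 hne); rewrite eq_sym in hne.
by move=> /(_ _ (min1 m' h2 hne)); rewrite lexlt_irr.
Qed.

Lemma volume_lexmin_inj F F' m : For n F -> For n F' ->
  lexmin (V F) m -> lexmin (V F') m -> F = F'.
Proof.
move=> /For_list[ts hF hn] /For_list[us hF' hn'].
have hsz vs : sumn (map nleaves vs) = n -> size (leaf_codes vs) =
  n by rewrite size_leaf_codes.
move=> /(lexmin_uniq (volume_leaf_code hF hn)) e1 /(lexmin_uniq (volume_leaf_code hF'
  hn')) e2.
have e : mnm_of_seq n 0 (leaf_codes ts) = mnm_of_seq n 0 (leaf_codes us) by rewrite e1.
have /leaf_codes_inj e' := mnm_of_seq_inj (hsz _ hn) (hsz _ hn') e.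
by apply: represents_inj hF _; rewrite e'.
Qed.

Lemma ballot_volume (m : 'X_{1..n}) : ballot 0 m -> exists2 F, For n F & lexmin (V F) m.
Proof.
move=> /ballot_parse[ts [hc _]]; have [F hF] := represents_exists ts.
have hn : sumn (map nleaves ts) = n by rewrite -size_leaf_codes hc size_tuple.
have -> : m = mnm_of_seq n 0 (leaf_codes ts).
  by apply/mnmP => i; rewrite mnm_of_seqE /= subn0 hc (mnm_nth 0%N).
exists F; last exact: volume_leaf_code.
by have := list_For hF; rewrite hn.
Qed.

Lemma ballot_mdeg (m : 'X_{1..n}) : ballot 0 m -> (mdeg m < n.+1)%N.
Proof.
move=> /ballot_parse[ts [_ hs]]; rewrite /mdeg -sumnE ltnS.
by have := leq_addl (size ts) (sumn m); rewrite hs size_tuple.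
Qed.

Definition spanned (f : {mpoly rat[n]}) := exists (s : seq forest) (c : forest -> rat),
  [/\ uniq s, forall F, F \in s -> For n F & f = \sum_(F <- s) c F *: V F].

Lemma spanned_add f F a : For n F -> spanned f -> spanned (f + a *: V F).
Proof.
move=> hF [s [c [us hs ->]]].
case: (boolP (F \in s)) => hFs.
  exists s, (fun G => c G + (if G == F then a else 0)); split=> //.
  under [RHS]eq_bigr do rewrite scalerDl.
  rewrite big_split /=; congr (_ + _).
  rewrite (bigD1_seq F) //= eqxx big1 ?addr0 // => G /negbTE ->.
  by rewrite scale0r.
exists (F :: s), (fun G => if G == F then a else c G); split; first by rewrite /= hFs.
  by move=> G; rewrite inE => /orP[/eqP ->|/hs].
rewrite big_cons eqxx addrC; congr (_ + _); apply: eq_big_seq => G hG.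
by case: eqP => // e; move: hFs; rewrite -e hG.
Qed.

Lemma HQSym_sub f g a : HQSym n f -> HQSym n g -> HQSym n (f - a *: g).
Proof.
move=> /HQSymP hf /HQSymP hg; apply/HQSymP => al h1 h2.
by rewrite -scaleNr diffopDr diffopZr hf // hg // scaler0 addr0.
Qed.

(** Subtracting a multiple of the volume polynomial with the same least
    monomial raises the least monomial, which stays among the finitely many
    ballot sequences. *)
Lemma HQSym_spanned f : HQSym n f -> spanned f.
Proof.
(* The induction is on the number of monomials of degree at most n that are not
   below the least monomial of f. *)
pose above m := [set x : 'X_{1..n < n.+1} | ~~ lexlt x m].
suff H k m : lexmin f m -> (#|above m| <= k)%N -> HQSym n f -> spanned f.
  move=> hf; have [->|fn0] := eqVneq f 0; first by exists [::], (fun=> 0);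
    rewrite big_nil.
  by have [m hm] := lexmin_exists fn0; apply: H hm (leqnn _) hf.
elim: k f m => [|k IH] f m hm hk hf; have hg := HQSym_lexmin_ballot hf hm.
  have : BMultinom (ballot_mdeg hg) \in above m by rewrite inE lexlt_irr.
  by move: hk; rewrite leqn0 cards_eq0 => /eqP ->; rewrite inE.
have [F hF hFm] := ballot_volume hg.
pose a := f@_m / (V F)@_m; pose f' := f - a *: V F.
have hf' : HQSym n f' by apply: HQSym_sub (volume_HQSym hF).
have -> : f = f' + a *: V F by rewrite subrK.
apply: spanned_add => //.
have [->|fn0] := eqVneq f' 0; first by exists [::], (fun=> 0); rewrite big_nil.
have [m' hm'] := lexmin_exists fn0; apply: (IH f' m' hm') => //.
have f'm : f'@_m = 0.
  rewrite mcoeffB mcoeffZ /a divfK ?subrr // -mcoeff_msupp; by case: hFm.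
have lt : lexlt m m'.
  have [hin _] := hm'; have hne : m' != m.
    by apply: contraTneq hin => ->; rewrite mcoeff_msupp f'm eqxx.
  have := msuppB_le hin; rewrite mem_cat => /orP[/(hm.2)|/msuppZ_le/(hFm.2)]; exact.
rewrite -ltnS; apply: leq_trans hk; apply: proper_card; apply/properP; split.
  apply/fintype.subsetP => y; rewrite !inE; apply: contra => /lexlt_trans; exact.
exists (BMultinom (ballot_mdeg hg)); rewrite inE ?lexlt_irr //=.
by rewrite negbK.
Qed.

(** The least of the least monomials of the terms cannot cancel. *)
Lemma volume_free (s : seq forest) (c : forest -> rat) : uniq s ->
  (forall F, F \in s -> For n F) -> \sum_(F <- s) c F *: V F = 0 ->
  forall F, F \in s -> c F = 0.
Proof.
move=> us hs h0 F0 hF0; apply/eqP; apply: contraT => cF0.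
pose lm F := xget 0%MM [set m | lexmin (V F) m]%classic.
have lmP F : For n F -> lexmin (V F) (lm F).
  by move=> /volume_lexmin ex; apply: (xgetPex 0%MM ex).
pose s' := [seq F <- s | c F != 0].
have : map lm s' != [::].
  have : F0 \in s' by rewrite mem_filter cF0.
  by case: (s').
case/lex_seq_min => m [/mapP[F hF ->] hmin].
move: hF; rewrite mem_filter => /andP[cF hF]; have hFF := hs F hF.
have := congr1 (mcoeff (lm F)) h0; rewrite raddf_sum mcoeff0 (bigD1_seq F) //= big1_seq.
  rewrite addr0 mcoeffZ => /eqP; rewrite mulf_eq0 (negbTE cF) /=.
  by have [+ _] := lmP F hFF; rewrite mcoeff_msupp => /negbTE ->.
move=> G /andP[hne hG]; rewrite mcoeffZ; have [->|cG] := eqVneq (c G) 0;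
  first by rewrite mul0r.
have hGG := hs G hG.
rewrite (lexmin_coef0 (lmP G hGG)) ?mulr0 //.
apply: hmin; first by apply: map_f; rewrite mem_filter cG.
apply: contra hne => /eqP e; apply/eqP; apply: (volume_lexmin_inj hGG hFF (m := lm F)).
  by rewrite -e; apply: lmP.
exact: lmP.
Qed.
End Basis.

Theorem theorem10p10 (R : realType) (n : nat) (hn : (1 <= n)%N) :
  is_basis (HQSym n) (For n) (fun F : forest => volume_poly R F n).
Proof.
split; [exact: volume_HQSym|exact: volume_free|exact: HQSym_spanned].
Qed.
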